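(* Let $\Delta$ be a thick building and $\Delta'$ an arbitrary building, endowed with arbitrary systems of apartments $\mathcal{A}$ and $\mathcal{A}'$, respectively. Let $\varphi$ be a map from the set of chambers of $\Delta$ to the set of chambers of $\Delta'$ which, for every apartment $\Sigma\in\mathcal{A}$, maps the set of chambers of $\Sigma$ bijectively onto the set of chambers of some apartment $\Sigma'\in\mathcal{A}'$. Then $\varphi$ is injective and preserves adjacency of chambers. Hence $\varphi$ induces a simplicial isomorphism of $\Delta$ onto a thick subbuilding of $\Delta'$ in case $\Delta$ is $2$-spherical.
   Context: Buildings are finite-dimensional simplicial complexes (chamber complexes admitting a system of apartments satisfying Tits' axioms), of arbitrary type. Chambers are the maximal simplices, panels the simplices of codimension 1; a building is thick if each panel is contained in at least three chambers. Two chambers are adjacent if they are different and share a common panel. A system of apartments of a building is any subset of its complete (maximal) apartment system such that any two chambers are contained in some member of the subset. A subbuilding of $\Delta'$ is a chamber subcomplex (generated by chambers of $\Delta'$) that is itself a building having as apartment system a set of apartments of $\Delta'$. A building of type $(W,S)$ is $2$-spherical if for all $s,t\in S$ the order of $st$ in $W$ is finite. *)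

(* Defs.v *)
From HB Require Import structures.
From mathcomp Require Import all_boot finmap.
From mathcomp Require Import boolp classical_sets functions cardinality.
From Stdlib Require Import Relation_Operators.

Set Implicit Arguments.
Unset Strict Implicit.
Unset Printing Implicit Defensive.

Local Open Scope classical_set_scope.

(* A simplicial complex is given by its set of simplices (the empty simplex
   included).  Not every v : V need be a vertex, i.e. have [fset v] a simplex,
   so a subcomplex is just a smaller set of simplices over the same V. *)
Section SimplicialComplex.
Variable V : choiceType.
Implicit Types (K L : set {fset V}) (A B C D P : {fset V}).

Definition simplicial_complex K : Prop :=
  K fset0 /\ forall A B, K B -> (A `<=` B)%fset -> K A.

Definition chamber K : set {fset V} :=
  [set C | K C /\ forall D, K D -> (C `<=` D)%fset -> D = C].

Definition panel K : set {fset V} :=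
  [set P | exists2 C, chamber K C & (P `<=` C)%fset /\ #|` C| = (#|` P|).+1].

Definition adjacent K C D : Prop :=
  [/\ chamber K C, chamber K D, C <> D
    & exists2 P, panel K P & (P `<=` C)%fset /\ (P `<=` D)%fset].

Definition finite_dimensional K : Prop :=
  exists n : nat, forall A, K A -> #|` A| <= n.

Definition chamber_complex K : Prop :=
  [/\ simplicial_complex K,
      finite_dimensional K,
      (forall C D, chamber K C -> chamber K D -> #|` C| = #|` D|)
    & (forall C D, chamber K C -> chamber K D ->
         clos_refl_trans _ (adjacent K) C D)].

Definition thick K : Prop :=
  forall P, panel K P -> exists C1 C2 C3,
    [/\ chamber K C1, chamber K C2 & chamber K C3] /\
    [/\ C1 <> C2, C1 <> C3 & C2 <> C3] /\
    [/\ (P `<=` C1)%fset, (P `<=` C2)%fset & (P `<=` C3)%fset].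

Definition generated_subcomplex (X : set {fset V}) : set {fset V} :=
  [set A | exists2 C, X C & (A `<=` C)%fset].

End SimplicialComplex.

(* Complexes are identified with their posets of simplices ordered by the face
   relation: f acts on simplices, and its values outside K are irrelevant.  It
   maps vertices to vertices and is determined by its action on them. *)
Definition simplicial_iso (V V' : choiceType) (K : set {fset V})
    (L : set {fset V'}) (f : {fset V} -> {fset V'}) : Prop :=
  set_bij K L f /\
  forall A B, K A -> K B -> ((A `<=` B)%fset <-> (f A `<=` f B)%fset).

Section Coxeter.
Local Open Scope group_scope.
Variable W : groupType.
Implicit Types (S J H : set W) (s t w : W).

Definition subgroup H : Prop := H 1 /\ forall x y, H x -> H y -> H (x / y).

Definition generated J : set W := smallest [set H | subgroup H] J.

(* W = < S | (s t)^m(s,t) = 1 >, where m(s,t) is the order of s t in W; the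
   presentation is expressed by its universal property.  The relations s^2 = 1
   are the instances s = t, n = 1. *)
Definition coxeter_system S : Prop :=
  [/\ (forall s, S s -> s <> 1 /\ s * s = 1),
      generated S = setT
    & forall (G : groupType) (f : W -> G),
        (forall s t (n : nat), S s -> S t ->
           (s * t) ^+ n = 1 -> (f s * f t) ^+ n = 1) ->
        exists2 g : W -> G, monoid_morphism g & forall s, S s -> g s = f s].

Definition standard_coset S : set (set W) :=
  [set X | exists w J, J `<=` S /\ X = [set w * x | x in generated J]].

(* Sigma(W,S) is the poset of standard cosets ordered by reverse inclusion. *)
Definition iso_coxeter_complex S (V : choiceType) (K : set {fset V}) : Prop :=
  exists2 g : {fset V} -> set W,
    set_bij K (standard_coset S) g &
    forall A B, K A -> K B -> ((A `<=` B)%fset <-> g B `<=` g A).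

Definition finite_order w : Prop := exists2 n : nat, 0 < n & w ^+ n = 1.

End Coxeter.

Section Building.
Variable V : choiceType.
Implicit Types (Delta Sigma : set {fset V}) (A : set (set {fset V})).

Definition coxeter_complex Sigma : Prop :=
  exists (W : groupType) (S : set W),
    [/\ coxeter_system S, finite_set S & iso_coxeter_complex S Sigma].

Definition tits_axioms Delta A : Prop :=
  [/\ (forall Sigma, A Sigma -> Sigma `<=` Delta /\ simplicial_complex Sigma),
      (forall Sigma, A Sigma -> coxeter_complex Sigma),
      (forall a b, Delta a -> Delta b ->
         exists Sigma, [/\ A Sigma, Sigma a & Sigma b])
    & (forall Sigma Sigma' a b, A Sigma -> A Sigma' ->
         Sigma a -> Sigma b -> Sigma' a -> Sigma' b ->
         exists2 f : {fset V} -> {fset V}, simplicial_iso Sigma Sigma' f &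
           forall c, (c `<=` a)%fset \/ (c `<=` b)%fset -> f c = c)].

Definition building Delta : Prop :=
  chamber_complex Delta /\ exists A, tits_axioms Delta A.

Definition complete_apartment_system Delta A : Prop :=
  tits_axioms Delta A /\ forall B, tits_axioms Delta B -> B `<=` A.

Definition apartment_system Delta A : Prop :=
  exists2 Ac, complete_apartment_system Delta Ac &
    A `<=` Ac /\
    forall C D, chamber Delta C -> chamber Delta D ->
      exists Sigma, [/\ A Sigma, Sigma C & Sigma D].

Definition building_type Delta (W : groupType) (S : set W) : Prop :=
  coxeter_system S /\
  exists2 Ac, complete_apartment_system Delta Ac &
    forall Sigma, Ac Sigma -> iso_coxeter_complex S Sigma.

Definition two_spherical Delta : Prop :=
  exists (W : groupType) (S : set W), building_type Delta S /\
    forall s t, S s -> S t -> finite_order (s * t)%g.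

(* Gamma is a subbuilding of the building Delta endowed with the apartments A. *)
Definition subbuilding Delta A (Gamma : set {fset V}) : Prop :=
  [/\ (exists2 X, X `<=` chamber Delta & Gamma = generated_subcomplex X),
      building Gamma
    & exists2 B, B `<=` A & apartment_system Gamma B].

End Building.

(* Main.v *)
(** Any two chambers lie in a common apartment, so phi is injective.  Apartments
are convex, i.e. they contain every minimal gallery between two of their
chambers, because they are retracts of the building; the image under phi of an
intersection of apartments is again such an intersection, hence convex.  If
C, D, E are chambers with D, E adjacent and d(C,E) = d(C,D) + 1, a third chamber
F on the panel of D and E (thickness) yields an apartment through C and F, which
contains D but not E.  Consequently the apartments through two adjacent chambers
have nothing else in common, so phi preserves adjacency, and an induction on the
distance shows that phi preserves the gallery distance.

So phi restricts to isometries between the Cayley graphs of the Coxeter groups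
of the apartments.  If s t has finite order, such an isometry F maps w<s,t> into
the coset F(w)<s',t'>: the gate q on F(w)<s',t'> of the image of the longest
element of w<s,t> is farther from F(w) than from F(ws) and F(wt), and then
F(w<s,t>) lies in the convex hull of F(w) and q.  Hence the bijection between
the vertices of C and those of phi C, matching opposite panels, does not change
from a chamber C to an adjacent one, and these bijections glue to an isomorphism
of the complexes. *)

Require Import Defs.
From HB Require Import structures.
From mathcomp Require Import all_boot finmap.
From mathcomp Require Import boolp classical_sets functions cardinality.
From mathcomp Require Import zify.
From Stdlib Require Import Relation_Operators.

Set Implicit Arguments.
Unset Strict Implicit.
Unset Printing Implicit Defensive.

Local Open Scope classical_set_scope.

(** * Coxeter groups *)

(** Z/2 as a multiplicative group, the target of the sign homomorphism. The alias carries the group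
    structure in place of [bool]. *)
Definition parity_group : Type := bool.
HB.instance Definition _ := Choice.on parity_group.
HB.instance Definition _ :=
  isGroup.Build parity_group addbA addFb addbF addbb addbb.

Section ReflectionCocycle.
Local Open Scope group_scope.
Variable W : groupType.

(* The semidirect product of W with (Z/2)^W, where W acts by conjugation on the
   exponents; the homomorphism s |-> (s, indicator of s) into it is the
   reflection cocycle, which computes the walls separating 1 from w. *)
Definition cocycle_group : Type := W * (W -> bool).

HB.instance Definition _ := gen_eqMixin cocycle_group.
HB.instance Definition _ := gen_choiceMixin cocycle_group.

Definition cocycle_mul (x y : cocycle_group) : cocycle_group :=
  (x.1 * y.1, fun r => x.2 r (+) y.2 (r ^ x.1)).
Definition cocycle_one : cocycle_group := (1, fun=> false).
Definition cocycle_inv (x : cocycle_group) : cocycle_group :=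
  (x.1^-1, fun r => x.2 (r ^ x.1^-1)).

Lemma cocycle_mulA : associative cocycle_mul.
Proof.
move=> x y z; rewrite /cocycle_mul /= mulgA; congr pair; apply: funext => r.
by rewrite addbA conjgM.
Qed.

Lemma cocycle_mul1 : left_id cocycle_one cocycle_mul.
Proof.
move=> [w h]; rewrite /cocycle_mul /= mul1g; congr pair; apply: funext => r.
by rewrite conjg1.
Qed.

Lemma cocycle_1mul : right_id cocycle_one cocycle_mul.
Proof.
move=> [w h]; rewrite /cocycle_mul /= mulg1; congr pair; apply: funext => r.
by rewrite addbF.
Qed.

Lemma cocycle_mulV : left_inverse cocycle_one cocycle_inv cocycle_mul.
Proof.
move=> [w h]; rewrite /cocycle_mul /= mulVg; congr pair; apply: funext => r.
by rewrite addbb.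
Qed.

Lemma cocycle_Vmul : right_inverse cocycle_one cocycle_inv cocycle_mul.
Proof.
move=> [w h]; rewrite /cocycle_mul /= mulgV; congr pair; apply: funext => r.
by rewrite -conjgM mulgV conjg1 addbb.
Qed.

HB.instance Definition _ := isGroup.Build cocycle_group cocycle_mulA
  cocycle_mul1 cocycle_1mul cocycle_mulV cocycle_Vmul.

Definition reflection_elt (s : W) : cocycle_group := (s, fun r => r == s).

Section Dihedral.
Variables s t : W.
Hypotheses (ss : s * s = 1) (tt : t * t = 1).
Let a := s * t.

Lemma involution_inv : s^-1 = s.
Proof. by apply: mulg1_eq. Qed.

(** The involution s inverts a, so moving s across a power of a changes the sign of the exponent,
    and conjugation doubles it. *)
Lemma conj_dihedral i : s ^ (a ^- i) = a ^+ i.*2 * s.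
Proof.
have as_ : s * a^-1 = a * s.
  by rewrite /a invgM involution_inv (mulg1_eq tt) mulgA.
have {}as_ k : s * a ^- k = a ^+ k * s.
  elim: k => [|k IH]; first by rewrite invg1 mul1g mulg1.
  by rewrite expgSr invgM mulgA as_ -mulgA IH mulgA -expgS expgSr.
by rewrite conjgE invgK as_ mulgA -expgnDr addnn.
Qed.

(** The exponent collects, modulo 2, the reflections a^j s met along the alternating word of length
    2n. It decides whether the Coxeter relations hold in [cocycle_group]. *)
Lemma reflection_elt_pow n :
  (reflection_elt s * reflection_elt t) ^+ n =
  (a ^+ n, fun r => \big[addb/false]_(0 <= j < n.*2) (r == a ^+ j * s)).
Proof.
elim: n => [|n IH].
  by congr pair; apply: funext => r; rewrite big_geq.
rewrite expgSr IH; congr pair; first by rewrite expgSr.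
apply: funext => r /=; rewrite doubleS !big_nat_recr //= -addbA; congr addb.
have E x : (r ^ a ^+ n == x) = (r == x ^ (a ^- n)).
  by apply/eqP/eqP => [<-|->]; rewrite -conjgM ?mulgV ?mulVg conjg1.
rewrite E conj_dihedral -conjgM; congr addb.
have -> : (r ^ (a ^+ n * s) == t) = (r ^ a ^+ n == t ^ s^-1).
  by rewrite conjgM; apply/eqP/eqP => [<-|->]; rewrite -conjgM ?mulgV ?mulVg conjg1.
rewrite E; congr (_ == _).
have -> : t ^ s^-1 = a * s by rewrite conjgE invgK involution_inv mulgA.
have aa : a ^ (a ^- n) = a.
  by rewrite conjgE invgK mulgA -expgSr expgS mulgK.
by rewrite conjMg conj_dihedral aa expgS mulgA.
Qed.

End Dihedral.
End ReflectionCocycle.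

(** Locates the letter deleted by the exchange condition in one of two concatenated words. *)
Lemma cat_eq_cat_cons (T : Type) (us vs us1 us2 : seq T) t :
    us ++ vs = us1 ++ t :: us2 ->
  (exists us2', us = us1 ++ t :: us2' /\ us2 = us2' ++ vs) \/
  (exists us1', us1 = us ++ us1' /\ vs = us1' ++ t :: us2).
Proof.
elim: us us1 => [|u us IH] [|u1 us1] /=.
- by move=> ->; right; exists [::].
- by move=> ->; right; exists (u1 :: us1).
- by move=> [-> <-]; left; exists us.
- move=> [<- /IH [[us2' [-> ->]]|[us1' [-> ->]]]]; [left|right].
    by exists us2'.
  by exists us1'.
Qed.

(** * Words and generated subgroups *)

Section Words.
Local Open Scope group_scope.
Variable W : groupType.
Implicit Types (J S : set W) (u v w x y z s t r : W) (us vs ws : seq W).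

Definition wprod ws : W := foldr (fun s w => s * w) 1 ws.
Definition word J ws : Prop := forall s, s \in ws -> J s.
Definition involutions J : Prop := forall s, J s -> s * s = 1.

Lemma wprod_cat us vs : wprod (us ++ vs) = wprod us * wprod vs.
Proof. by elim: us => [|s us IH] /=; rewrite ?mul1g // IH mulgA. Qed.

Lemma word_cons J s ws : word J (s :: ws) <-> J s /\ word J ws.
Proof.
split=> [h|[Js h] u].
  by split=> [|u uws]; apply: h; rewrite inE ?eqxx // uws orbT.
by rewrite inE => /orP[/eqP->|/h].
Qed.

Lemma word_cat J us vs : word J (us ++ vs) <-> word J us /\ word J vs.
Proof.
split=> [h|[h1 h2] u]; last by rewrite mem_cat => /orP[/h1|/h2].
by split=> u uu; apply: h; rewrite mem_cat uu ?orbT.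
Qed.

Lemma sub_word J S ws : J `<=` S -> word J ws -> word S ws.
Proof. by move=> JS h u /h /JS. Qed.

Lemma generated_subgroup J : subgroup (generated J).
Proof.
split=> [H [[]]//|x y hx hy H hH].
by case: (hH) => -[_ h] _; apply: h; [apply: hx|apply: hy].
Qed.

Lemma sub_generated J : J `<=` generated J.
Proof. by move=> x Jx H [_]; apply. Qed.

Lemma generated_min J H : subgroup H -> J `<=` H -> generated J `<=` H.
Proof. by move=> hH JH x; apply. Qed.

Lemma generated1 J : generated J 1.
Proof. by case: (generated_subgroup J). Qed.

Lemma generatedV J x : generated J x -> generated J x^-1.
Proof.
by case: (generated_subgroup J) => h1 h hx; rewrite -div1g; apply: h.
Qed.

Lemma generatedM J x y : generated J x -> generated J y -> generated J (x * y).
Proof.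
case: (generated_subgroup J) => h1 h hx hy; rewrite -[y]invgK; apply: h => //.
exact: generatedV.
Qed.

Lemma wprod_generated J ws : word J ws -> generated J (wprod ws).
Proof.
elim: ws => [|s ws IH] /= hw; first exact: generated1.
have [Js /IH h] := (word_cons J s ws).1 hw.
by apply: generatedM => //; apply: sub_generated.
Qed.

Lemma wprod_rev J ws : involutions J -> word J ws ->
  wprod (rev ws) = (wprod ws)^-1.
Proof.
move=> iJ; elim: ws => [|s ws IH] /= hw; first by rewrite invg1.
have [Js /IH h] := (word_cons J s ws).1 hw.
by rewrite rev_cons -cats1 wprod_cat h /= mulg1 invgM (mulg1_eq (iJ _ Js)).
Qed.

Lemma generatedP J w : involutions J ->
  generated J w <-> exists2 ws, word J ws & wprod ws = w.
Proof.
move=> iJ; split=> [|[ws hws <-]]; last exact: wprod_generated.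
move: w; apply: (@generated_min J
  [set w | exists2 ws, word J ws & wprod ws = w]) => [|s Js]; last first.
  by exists [:: s]; rewrite /= ?mulg1 // => u; rewrite inE => /eqP->.
split; first by exists [::].
move=> _ _ [us hu <-] [vs hv <-]; exists (us ++ rev vs).
  by apply/word_cat; split=> // u; rewrite mem_rev; apply: hv.
by rewrite wprod_cat (wprod_rev iJ).
Qed.

Lemma generated0 : generated set0 = [set (1 : W)].
Proof.
apply/seteqP; split=> [|_ ->]; last exact: generated1.
apply: generated_min => //; split=> // x y -> ->.
by rewrite /= divg1.
Qed.

Lemma generated_involution s : s * s = 1 -> generated [set s] = [set 1; s].
Proof.
move=> ss; apply/seteqP; split=> [|x [->|->]]; last 2 first.
- exact: generated1.
- exact: sub_generated.
apply: generated_min => [|_ -> /=]; last by right.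
have sV : s^-1 = s by apply: mulg1_eq.
split=> [|x y [->|->] [->|->]] /=; first by left.
- by rewrite divg1; left.
- by rewrite mul1g sV; right.
- by rewrite divg1; right.
- by rewrite mulgV; left.
Qed.

End Words.

(** * Word length, the exchange condition and parabolic cosets *)

Section Coxeter.
Local Open Scope group_scope.
Variables (W : groupType) (S : set W).
Implicit Types (J : set W) (u v w x y z s t r : W) (us vs ws : seq W).

Definition has_length w n := `[< exists ws, [/\ word S ws, wprod ws = w & size ws = n] >].

(** The default 0 is never reached when S is a set of involutions generating W. *)
Definition len w : nat :=
  if pselect (exists n, has_length w n) is left h then ex_minn h else 0.

Hypothesis HS : coxeter_system S.

Lemma coxeter_involutions : involutions S.
Proof. by case: HS => h _ _ s /h[]. Qed.
Local Notation iS := coxeter_involutions.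

Lemma gen_neq1 s : S s -> s <> 1.
Proof. by case: HS => h _ _ /h[]. Qed.

Lemma len_word w : exists ws, [/\ word S ws, wprod ws = w & size ws = len w].
Proof.
rewrite /len; case: pselect => [h|nh].
  by case: ex_minnP => n /asboolP[ws [? ? ?]] _; exists ws.
case: nh; have : generated S w by case: HS => _ ->.
by case/(generatedP _ iS) => ws hws <-; exists (size ws); apply/asboolP; exists ws.
Qed.

Lemma len_le ws : word S ws -> len (wprod ws) <= size ws.
Proof.
move=> hws; have hl : has_length (wprod ws) (size ws) by apply/asboolP; exists ws.
rewrite /len; case: pselect => [h|[]]; last by exists (size ws).
by case: ex_minnP => n _; apply.
Qed.

Lemma len1 : len 1 = 0.
Proof. by apply/eqP; rewrite -leqn0; apply: (@len_le [::]). Qed.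

Lemma len_eq0 w : len w = 0 -> w = 1.
Proof. by have [ws [_ <-]] := len_word w; case: ws => [|s ws] <-. Qed.

Lemma lenV w : len w^-1 = len w.
Proof.
have le x : len x^-1 <= len x.
  have [ws [hw <- <-]] := len_word x.
  rewrite -(wprod_rev iS hw) -size_rev; apply: len_le => s.
  by rewrite mem_rev; apply: hw.
by apply/eqP; rewrite eqn_leq le -{1}[w]invgK le.
Qed.

Lemma lenM u v : len (u * v) <= len u + len v.
Proof.
have [us [hu <- <-]] := len_word u; have [vs [hv <- <-]] := len_word v.
by rewrite -wprod_cat -size_cat; apply/len_le/word_cat.
Qed.

Lemma len_gen s : S s -> len s = 1%N.
Proof.
move=> Ss; have := @len_le [:: s]; rewrite /= mulg1 => le1.
have /le1 : word S [:: s] by apply/word_cons.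
case E: (len s) => [|[|//]] // _.
by case: (gen_neq1 Ss); apply: len_eq0.
Qed.

Lemma len_eq1 s : len s = 1%N -> S s.
Proof.
have [[|t [|u ws]] [hws <- <-]] := len_word s => // _.
by rewrite /= mulg1; apply: hws; rewrite inE.
Qed.

(** The sign homomorphism. The constant map to the nontrivial element of Z/2 respects all relations
    because each product s t goes to the identity. *)
Lemma parity_morphism : exists2 p : W -> bool,
  (forall u v, p (u * v) = p u (+) p v) & forall s, S s -> p s.
Proof.
case: HS => _ _ univ.
have [|p [_ pM] pS] := univ parity_group (fun=> true).
  by move=> s t n _ _ _; apply: expg1n.
by exists p => // s /pS ->.
Qed.

Lemma odd_lenM u v : odd (len (u * v)) = odd (len u) (+) odd (len v).
Proof.
have [p pM pS] := parity_morphism.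
have p1 : p 1 = false by have := pM 1 1; rewrite mulg1; case: (p 1).
suff E w : odd (len w) = p w by rewrite !E.
have [ws [+ <- <-]] := len_word w; elim: ws => [|s ws IH] /= hw; first by rewrite p1.
have [Ss /IH ->] := (word_cons _ _ _).1 hw.
by rewrite pM (pS _ Ss).
Qed.

(** The triangle inequality bounds the change of length by 1, and parity excludes no change. *)
Lemma len_genM s w : S s -> len (s * w) = (len w).+1 \/ len w = (len (s * w)).+1.
Proof.
move=> Ss; have := odd_lenM s w; have := lenM s w.
have := lenM s (s * w); rewrite mulgA (iS Ss) mul1g (len_gen Ss).
by lia.
Qed.

(** [N w r] records whether the wall of r separates 1 from w. It is the second component of the
    homomorphism into [cocycle_group] given by the universal property. *)
Lemma reflection_cocycle : exists N : W -> W -> bool,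
  [/\ forall r, N 1 r = false,
      forall s w r, S s -> N (s * w) r = (r == s) (+) N w (r ^ s)
    & forall s, S s -> N s s].
Proof.
case: HS => _ _ univ.
have [|g [g1 gM] gS] := univ _ (@reflection_elt W).
  move=> s t n Ss St st1.
  rewrite reflection_elt_pow ?(iS Ss) ?(iS St) // st1; congr pair.
  (* As (s t)^n = 1, the terms of index j and j + n are equal, so the two halves of the sum
     cancel. *)
  apply: funext => r; rewrite -addnn (@big_cat_nat _ _ _ n) ?leq_addr //=.
  rewrite -[X in index_iota X (n + n)]add0n big_addn addnK.
  under [X in _ (+) X]eq_bigr => i _ do rewrite expgnDr st1 mulg1.
  by rewrite addbb.
have g1E w : (g w).1 = w.
  have : generated S w by case: HS => _ ->.
  case/(generatedP _ iS) => ws + <-; elim: ws => [|s ws IH] /= hw.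
    by rewrite g1.
  have [Ss /IH h] := (word_cons _ _ _).1 hw.
  by rewrite gM /= h gS.
exists (fun w => (g w).2); split=> [r|s w r Ss|s Ss].
- by rewrite g1.
- by rewrite gM gS.
- by rewrite gS //= eqxx.
Qed.

Theorem exchange s ws : S s -> word S ws ->
    len (s * wprod ws) < len (wprod ws) ->
  exists us t vs, ws = us ++ t :: vs /\ s * wprod ws = wprod us * wprod vs.
Proof.
have [N [N1 NM NS]] := reflection_cocycle.
(* If r counts for a word, it coincides with the reflection of some letter, and multiplication by r
   deletes that letter. *)
have del r : forall us, word S us -> N (wprod us) r ->
  exists us1 t us2, us = us1 ++ t :: us2 /\ r * wprod us = wprod us1 * wprod us2.
  move=> us; elim: us r => [|t us IH] r /= hw; first by rewrite N1.
  have [St /IH h] := (word_cons _ _ _).1 hw.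
  rewrite (NM _ _ _ St); case: eqP => [-> _|_ /= /h].
    by exists [::], t, us; split=> //; rewrite mulgA (iS St).
  move=> [us1 [t' [us2 [-> E]]]]; exists (t :: us1), t', us2; split=> //=.
  by rewrite -mulgA -E conjgE (involution_inv (iS St)) !mulgA (iS St) mul1g.
(* If s did not count for ws, it would count for s times ws; a deletion in a shortest word for the
   latter would then make ws no longer than s times ws. *)
move=> Ss hws lt; apply: (del s ws) => //; apply: contraLR lt => Nws; rewrite -leqNgt.
have [us [hu Eu su]] := len_word (s * wprod ws).
have : N (wprod us) s.
  rewrite Eu NM // eqxx conjgE (involution_inv (iS Ss)) mulgA (iS Ss) mul1g.
  by rewrite addTb.
case/(del _ _ hu) => us1 [t [us2 [Eus]]].
rewrite Eu mulgA (iS Ss) mul1g => Ews.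
move: hu; rewrite Eus => /word_cat[h1 /word_cons[_ h2]].
rewrite -su Ews -wprod_cat Eus; apply: leq_trans (len_le _) _; first exact/word_cat.
by rewrite !size_cat /=; lia.
Qed.

(* Prepending s in J to a word for u * x either lengthens it or, by exchange,
   deletes a letter: one of u, which leaves a word in J, or one of x, which
   contradicts minimality. *)
Lemma min_coset_len J x : J `<=` S ->
    (forall u, generated J u -> len x <= len (u * x)) ->
  forall u, generated J u ->
    exists ws, [/\ word J ws, wprod ws = u & len (u * x) = (size ws + len x)%N].
Proof.
move=> JS minx u; have iJ : involutions J by move=> s /JS /iS.
case/(generatedP _ iJ) => us + <-; elim: us => [|s us IH] /= hw.
  by exists [::]; rewrite mul1g.
have [Js /IH [ws [hws <- Ews]]] := (word_cons _ _ _).1 hw.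
have Ss := JS _ Js.
have [xs [hxs Ex sx]] := len_word x.
case: (len_genM (wprod ws * x) Ss) => E.
  exists (s :: ws); split=> //; first exact/word_cons.
  by rewrite -mulgA E Ews.
have := @exchange s (ws ++ xs) Ss; rewrite wprod_cat Ex => -[].
- by apply/word_cat; split=> //; apply: sub_word JS hws.
- by lia.
move=> ws1 [t [ws2 [Ecat Eprod]]].
have [[ws2' [Etake Edrop]]|[ws1' [Etake Edrop]]] := cat_eq_cat_cons Ecat.
- move: (hws); rewrite {1}Etake => /word_cat[h1 /word_cons[_ h2]].
  exists (ws1 ++ ws2'); split; first exact/word_cat.
    apply: (@mulIg _ x).
    by rewrite wprod_cat -!mulgA Eprod Edrop wprod_cat Ex.
  have sz : size ws = (size ws1 + (size ws2').+1)%N by rewrite {1}Etake size_cat.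
  by rewrite -mulgA size_cat; apply: succn_inj; rewrite -E Ews sz addnS !addSn.
- have : generated J ((wprod ws)^-1 * (s * wprod ws)).
    apply: generatedM; first by apply: generatedV; apply: wprod_generated.
    by apply: generatedM; [exact: sub_generated|exact: wprod_generated].
  move/minx; rewrite -!mulgA Eprod Etake wprod_cat -mulgA mulKg -wprod_cat.
  move: (hxs); rewrite {1}Edrop => /word_cat[h1 /word_cons[_ h2]].
  have /len_le : word S (ws1' ++ ws2) by apply/word_cat.
  by rewrite -sx Edrop !size_cat /=; lia.
Qed.

(** The case x = 1 of [min_coset_len]: elements of a parabolic subgroup have shortest words in its
    own generators. *)
Lemma generated_word J u : J `<=` S -> generated J u ->
  exists ws, [/\ word J ws, wprod ws = u & size ws = len u].
Proof.
move=> JS /(@min_coset_len J 1 JS) [v _|ws [hws Ews Elen]].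
  by rewrite len1.
by exists ws; split=> //; rewrite -(mulg1 u) Elen len1 addn0.
Qed.

Lemma generated_gen J s : J `<=` S -> S s -> generated J s -> J s.
Proof.
move=> JS Ss /(generated_word JS) [ws [hws]]; rewrite (len_gen Ss).
case: ws hws => [//|t [|//]] hws /= <- _; rewrite mulg1.
by apply: hws; rewrite inE.
Qed.

(** Each v in the parabolic subgroup begins a shortest word of u. When s is prepended to a word of
    v, exchange deletes a letter from the word of u; it cannot lie in the part coming from v, since
    the longer word is still reduced, so the remaining part gets shorter. *)
Lemma max_len_prefix J u v : J `<=` S ->
    (forall s, J s -> len (s * u) < len u) -> generated J v ->
  len u = (len v + len (v^-1 * u))%N.
Proof.
move=> JS maxu /(generated_word JS) [ws [+ <-]].
elim: ws => [|s ws IH] /= hw E; first by rewrite len1 invg1 mul1g.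
have [Js hws] := (word_cons _ _ _).1 hw; have Ss := JS _ Js.
have Sws := sub_word JS hws.
have Ews : size ws = len (wprod ws).
  have := len_le Sws; have := lenM s (wprod ws); rewrite (len_gen Ss); lia.
have {IH} := IH hws Ews; set y := (wprod ws)^-1 * u => Elen.
have [ys [hys Ey sy]] := len_word y.
have := @exchange s (ws ++ ys) Ss; rewrite wprod_cat Ey mulVKg => -[].
- exact/word_cat.
- exact: maxu.
move=> ws1 [t [ws2 [Ecat Eprod]]].
have [[ws2' [Etake Edrop]]|[ws1' [Etake Edrop]]] := cat_eq_cat_cons Ecat.
- move: (Sws); rewrite {1}Etake => /word_cat[h1 /word_cons[_ h2]].
  have /len_le : word S (ws1 ++ ws2') by apply/word_cat.
  have -> : wprod (ws1 ++ ws2') = s * wprod ws.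
    apply: (@mulIg _ y).
    by rewrite wprod_cat -!mulgA /y mulVKg Eprod Edrop wprod_cat Ey.
  by rewrite -E {1}Etake !size_cat /=; lia.
- have Ez : (s * wprod ws)^-1 * u = wprod (ws1' ++ ws2).
    rewrite invgM -mulgA (involution_inv (iS Ss)) Eprod {1}Etake wprod_cat.
    by rewrite -mulgA mulKg wprod_cat.
  move: (hys); rewrite {1}Edrop => /word_cat[h1 /word_cons[_ h2]].
  have /len_le : word S (ws1' ++ ws2) by apply/word_cat.
  have := lenM (s * wprod ws) ((s * wprod ws)^-1 * u); rewrite mulVKg.
  by rewrite Ez -E /=; move: sy; rewrite Edrop !size_cat /=; lia.
Qed.

Definition cdist x y := len (x^-1 * y).

Lemma cdistC x y : cdist x y = cdist y x.
Proof. by rewrite /cdist -lenV invgM invgK. Qed.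

Lemma cdistM w x y : cdist (w * x) (w * y) = cdist x y.
Proof. by rewrite /cdist invgM -mulgA mulKg. Qed.

(** The gate p is an element of the coset nearest to z. Then p^-1 z is shortest in its right coset
    of the parabolic subgroup, and [min_coset_len] adds up the lengths. *)
Lemma coset_gate J w z : J `<=` S -> exists2 p, generated J (w^-1 * p) &
  forall c, generated J (w^-1 * c) -> cdist c z = (cdist c p + cdist p z)%N.
Proof.
move=> JS.
pose P n := `[< exists2 p, generated J (w^-1 * p) & cdist p z = n >].
have exP : exists n, P n.
  by exists (cdist w z); apply/asboolP; exists w; rewrite ?mulVg //; apply: generated1.
case: (ex_minnP exP) => n /asboolP[p wp Ep] minn.
have wpc c : generated J (w^-1 * c) -> generated J (c^-1 * p).
  move=> wc; have -> : c^-1 * p = (w^-1 * c)^-1 * (w^-1 * p).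
    by rewrite invgM invgK -mulgA mulVKg.
  by apply: generatedM => //; apply: generatedV.
exists p => // c wc.
have [u gu|ws [hws Ews]] := @min_coset_len J (p^-1 * z) JS _ _ (wpc _ wc).
  have -> : u * (p^-1 * z) = (p * u^-1)^-1 * z by rewrite invgM invgK mulgA.
  rewrite -/(cdist p z) -/(cdist (p * u^-1) z) Ep; apply: minn; apply/asboolP.
  exists (p * u^-1) => //; rewrite mulgA; apply: generatedM => //.
  exact: generatedV.
have -> : c^-1 * p * (p^-1 * z) = c^-1 * z by rewrite -mulgA mulVKg.
rewrite -/(cdist c z) -/(cdist p z) => E.
have : cdist c z <= cdist c p + cdist p z.
  by rewrite /cdist; have := lenM (c^-1 * p) (p^-1 * z); rewrite -mulgA mulVKg.
have := len_le (sub_word JS hws); rewrite Ews -/(cdist c p); lia.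
Qed.

(** Let p be the gate of y. The distance from p to y is counted twice on the path from x through y
    to z, while the path through p is already at least as long as the distance from x to z. Hence p
    = y. *)
Lemma coset_convex J w x y z : J `<=` S ->
    generated J (w^-1 * x) -> generated J (w^-1 * z) ->
  (cdist x y + cdist y z)%N = cdist x z -> generated J (w^-1 * y).
Proof.
move=> JS wx wz E; have [p wp gp] := coset_gate w y JS.
have := gp _ wx; have := gp _ wz.
have : cdist x z <= cdist x p + cdist p z.
  by rewrite /cdist; have := lenM (x^-1 * p) (p^-1 * z); rewrite -mulgA mulVKg.
rewrite (cdistC z y) (cdistC z p) => h1 h2 h3.
have : cdist p y = 0 by lia.
by move/len_eq0/mulg1_eq; rewrite invgK => <-.
Qed.

Lemma dihedral_len_bounded s t n : S s -> S t -> 0 < n -> (s * t) ^+ n = 1 ->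
  exists b, forall u, generated [set s; t] u -> len u <= b.
Proof.
move=> Ss St n0 stn; pose a := s * t.
have sa : s * a = a^-1 * s.
  by rewrite invgM (involution_inv (iS Ss)) (involution_inv (iS St)) -mulgA (iS Ss) mulg1 mulgA (iS Ss) mul1g.
have sas i : s * a ^+ i = (a ^+ i)^-1 * s.
  elim: i => [|i IH]; first by rewrite invg1 mulg1 mul1g.
  by rewrite expgSr mulgA IH -mulgA sa mulgA -invgM -expgS expgSr.
have stJ : [set s; t] `<=` S by move=> _ [->|->].
have la : len a <= 2.
  by have := lenM s t; rewrite (len_gen Ss) (len_gen St).
have len_b i : len (a ^+ i * s) <= i.*2.+1.
  elim: i => [|i IH]; first by rewrite mul1g (len_gen Ss).
  by rewrite expgS -mulgA; apply: leq_trans (lenM _ _) (leq_add la IH).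
have len_a i : len (a ^+ i) <= i.*2.
  elim: i => [|i IH]; first by rewrite len1.
  by rewrite expgS; apply: leq_trans (lenM _ _) (leq_add la IH).
have red i : a ^+ i = a ^+ (i %% n).
  by rewrite {1}(divn_eq i n) expgnDr mulnC expgnA stn expg1n mul1g.
(* A crude bound: a has length at most 2, its exponents can be reduced modulo n, and each element of
   the dihedral group is a^i or a^i s. *)
exists n.*2.+1 => u.
move=> Ju; suff [i [->|->]] : exists i, u = a ^+ i \/ u = a ^+ i * s.
- by rewrite red; have := len_a (i %% n); have := ltn_pmod i n0; lia.
- by rewrite red; have := len_b (i %% n); have := ltn_pmod i n0; lia.
have inv i : exists j, (a ^+ i)^-1 = a ^+ j.
  exists (n - i %% n); rewrite red expgnFr ?stn ?mul1g //.
  exact/ltnW/ltn_pmod.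
have ht i : t * a ^+ i = s * a ^+ i.+1.
  by rewrite expgS /a !mulgA (iS Ss) mul1g.
case/(generatedP _ (fun r Jr => iS (stJ r Jr))): Ju => ws + <-.
elim: ws => [|r ws IH] /= hw; first by exists 0; left.
have [[->|->] /IH [i [->|->]]] := (word_cons _ _ _).1 hw.
- by rewrite sas; have [j ->] := inv i; exists j; right.
- by rewrite mulgA sas -mulgA (iS Ss) mulg1; have [j ->] := inv i; exists j; left.
- by rewrite ht sas; have [j ->] := inv i.+1; exists j; right.
- by rewrite mulgA ht sas -mulgA (iS Ss) mulg1; have [j ->] := inv i.+1; exists j; left.
Qed.

End Coxeter.

(** * Isometries between Cayley graphs of Coxeter groups *)

Section CoxeterIsometry.
Local Open Scope group_scope.
Variables (W W' : groupType) (S : set W) (S' : set W').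
Hypotheses (HS : coxeter_system S) (HS' : coxeter_system S').
Variable F : W -> W'.
Hypotheses (Fsurj : forall w', exists w, F w = w').
Hypotheses (Fiso : forall x y, cdist S' (F x) (F y) = cdist S x y).

Lemma isometry_residue w s t n s' t' : S s -> S t -> s <> t -> S' s' -> S' t' ->
    0 < n -> (s * t) ^+ n = 1 ->
    F (w * s) = F w * s' -> F (w * t) = F w * t' ->
  F (w * (s * t)) = F w * (s' * t').
Proof.
move=> Ss St st Ss' St' n0 stn Fs Ft.
pose J := [set s; t]; pose J' := [set s'; t'].
have JS : J `<=` S by move=> _ [->|->].
have JS' : J' `<=` S' by move=> _ [->|->].
have [b hb] := dihedral_len_bounded HS Ss St n0 stn.
(* Finite order bounds the lengths, so the dihedral group has a longest element q, which both s and
   t shorten. *)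
pose P k := `[< exists2 u, generated J u & len S u = k >].
have exP : exists k, P k.
  by exists (len S 1); apply/asboolP; exists 1 => //; apply: generated1.
have ubP k : P k -> k <= b by case/asboolP => u /hb + <-.
case: (ex_maxnP exP ubP) => k /asboolP[q Jq Eq] maxk.
have qmax r : J r -> len S (r * q) < len S q.
  move=> Jr; have : len S (r * q) <= k.
    by apply: maxk; apply/asboolP; exists (r * q) => //;
       apply: generatedM => //; apply: sub_generated.
  by case: (len_genM HS q (JS _ Jr)); lia.
(* Here p is the gate of F (w q) on the target coset and c is its preimage. The gate property pulls
   back along F to the points w, w s and w t. *)
have [p Jp gp] := coset_gate HS' (F w) (F (w * q)) JS'.
have [c Ec] := Fsurj p; subst p.
have {gp} gp r r' : F (w * r) = F w * r' -> generated J' r' ->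
    cdist S (w * r) (w * q) = (cdist S (w * r) c + cdist S c (w * q))%N.
  by move=> Er Jr; rewrite -!Fiso gp // Er mulKg.
have g1 : cdist S w (w * q) = (cdist S w c + cdist S c (w * q))%N.
  by have := gp 1 1; rewrite !mulg1; apply=> //; apply: generated1.
have gs := gp s s' Fs (sub_generated (or_introl erefl)).
have gt := gp t t' Ft (sub_generated (or_intror erefl)).
have Jc : generated J (w^-1 * c).
  apply: (@coset_convex _ _ HS J w w c (w * q) JS _ _ (esym g1)).
    by rewrite mulVg; apply: generated1.
  by rewrite mulKg.
(* As c lies between w q and each of w, w s, w t, subtracting the distance from c to w q shows that
   s and t also shorten w^-1 c. *)
have cmax r : J r -> len S (r * (w^-1 * c)) < len S (w^-1 * c).
  move=> Jr; have := qmax _ Jr; have rV := involution_inv (coxeter_involutions HS (JS _ Jr)).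
  have d1 : cdist S w (w * q) = len S q by rewrite /cdist mulKg.
  have d2 : cdist S (w * r) (w * q) = len S (r * q) by rewrite cdistM /cdist rV.
  have d3 : cdist S (w * r) c = len S (r * (w^-1 * c)).
    by rewrite /cdist invgM rV mulgA.
  have : cdist S (w * r) (w * q) = (cdist S (w * r) c + cdist S c (w * q))%N.
    by case: Jr => ->.
  by rewrite -d1 -d2 -d3 -/(cdist S w c) g1 => ->; rewrite ltn_add2r.
have Jst : generated J (s * t).
  by apply: generatedM; apply: sub_generated; [left|right].
(* Hence w s t lies between w and c, its image lies between F w and p, and convexity puts the image
   in the target coset. *)
have := max_len_prefix HS JS cmax Jst.
have -> : (s * t)^-1 * (w^-1 * c) = (w * (s * t))^-1 * c by rewrite [in RHS]invgM mulgA.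
rewrite -/(cdist S w c) -/(cdist S (w * (s * t)) c).
have <- : cdist S w (w * (s * t)) = len S (s * t) by rewrite /cdist mulKg.
rewrite -!Fiso => /esym/(coset_convex HS' JS' _ Jp); rewrite mulVg.
move=> Jd; have {}Jd : generated J' ((F w)^-1 * F (w * (s * t))).
  by apply: Jd; apply: generated1.
(* The image is adjacent to F w s', so it is F w s' r with r equal to s' or t'. The choice r = s'
   would give F w back and force s = t. *)
have : cdist S' (F (w * s)) (F (w * (s * t))) = 1%N.
  by rewrite Fiso cdistM /cdist mulKg (len_gen HS St).
move/(len_eq1 HS'); rewrite Fs; set r := (_^-1 * _) => Sr.
have Er : F (w * (s * t)) = F w * (s' * r) by rewrite [RHS]mulgA /r mulVKg.
have Jr : generated J' r.
  rewrite /r invgM -mulgA; apply: generatedM; last exact: Jd.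
  by apply: generatedV; apply: sub_generated; left.
have [Err|Err] := generated_gen HS' JS' Sr Jr; last by rewrite Er Err.
have : cdist S' (F w) (F (w * (s * t))) = 0.
  by rewrite Er Err (coxeter_involutions HS' Ss') mulg1 /cdist mulVg len1.
rewrite Fiso /cdist mulKg => /(len_eq0 HS) /mulg1_eq.
by rewrite (involution_inv (coxeter_involutions HS Ss)) => /st.
Qed.

End CoxeterIsometry.

(** * Simplicial complexes *)

Section Complexes.
Variable V : choiceType.
Implicit Types (K : set {fset V}) (A B C D P Q : {fset V}).

Lemma chamber_simplex K C : chamber K C -> K C.
Proof. by case. Qed.

Lemma face K A B : simplicial_complex K -> K B -> (A `<=` B)%fset -> K A.
Proof. by move=> [_ h] KB AB; apply: h AB. Qed.

Lemma fsub_card_eq A B : (A `<=` B)%fset -> #|` B| <= #|` A| -> A = B.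
Proof. by move=> AB le; apply/eqP; rewrite eqEfcard AB. Qed.

Lemma sub_chamber K A : finite_dimensional K -> K A ->
  exists2 C, chamber K C & (A `<=` C)%fset.
Proof.
move=> [n hn] KA.
pose P k := `[< exists2 B, K B & (A `<=` B)%fset /\ #|` B| = k >].
have exP : exists k, P k by exists #|` A|; apply/asboolP; exists A.
have ub k : P k -> k <= n by move=> /asboolP[B /hn + [_ <-]].
case: (ex_maxnP exP ub) => k /asboolP[C KC [AC Ck]] maxk.
exists C => //; split=> // D KD CD; apply/esym/fsub_card_eq => //.
rewrite Ck; apply: maxk; apply/asboolP; exists D => //; split=> //.
exact: fsubset_trans AC CD.
Qed.

Lemma fsetD1_sub A B : (A `<=` B)%fset -> A <> B ->
  exists x, [/\ x \in B, x \notin A & (A `<=` B `\ x)%fset].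
Proof.
move=> AB AneB; have /fset0Pn[x] : (B `\` A)%fset != fset0.
  rewrite fsetD_eq0; apply/negP => BA; apply: AneB.
  by apply/eqP; rewrite eqEfsubset AB.
rewrite inE => /andP[xA xB].
by exists x; split=> //; rewrite fsubsetD1 AB.
Qed.

Lemma panel_fsetD1 P C : (P `<=` C)%fset -> #|` C| = #|` P|.+1 ->
  exists x, [/\ x \in C, x \notin P & P = C `\ x]%fset.
Proof.
move=> PC card; have [|x [xC xP PCx]] := fsetD1_sub PC.
  by move=> E; move: card; rewrite E; lia.
exists x; split=> //; apply: fsub_card_eq => //.
by have := cardfsD1 x C; rewrite xC card; lia.
Qed.

Lemma card_fsetD1 x C : x \in C -> #|` C| = #|` (C `\ x)%fset|.+1.
Proof. by move=> xC; rewrite (cardfsD1 x C) xC. Qed.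

Lemma panel_cap P C D : (P `<=` C)%fset -> (P `<=` D)%fset -> C <> D ->
  #|` C| = #|` P|.+1 -> #|` C| = #|` D| -> P = (C `&` D)%fset.
Proof.
move=> PC PD CneD cardP cardD; apply: fsub_card_eq; first by rewrite fsubsetI PC.
rewrite -ltnS -cardP ltnNge; apply/negP => le.
have CI : (C `&` D)%fset = C by apply: fsub_card_eq le; rewrite fsubsetIl.
have CD : (C `<=` D)%fset by rewrite -CI fsubsetIr.
by apply: CneD; apply: fsub_card_eq; rewrite // cardD.
Qed.

Lemma adjacentC K C D : adjacent K C D -> adjacent K D C.
Proof. by move=> [hC hD CD [P pP [PC PD]]]; split=> //; [exact/nesym|exists P]. Qed.

End Complexes.

(** * Isomorphisms of simplicial complexes and their action on vertices *)

Section Isomorphisms.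
Variables (V V' : choiceType) (K : set {fset V}) (L : set {fset V'}).
Variable f : {fset V} -> {fset V'}.
Hypotheses (cK : simplicial_complex K) (cL : simplicial_complex L).
Hypothesis isof : simplicial_iso K L f.
Implicit Types (A C D P : {fset V}).

Lemma iso_fun A : K A -> L (f A).
Proof. by case: isof => -[h _ _] _ /h. Qed.

Lemma iso_inj A B : K A -> K B -> f A = f B -> A = B.
Proof. by case: isof => -[_ h _] _ KA KB; apply: h; rewrite inE. Qed.

Lemma iso_surj B : L B -> exists2 A, K A & f A = B.
Proof. by case: isof => -[_ _ h] _ /h[A KA <-]; exists A. Qed.

Lemma iso_sub A B : K A -> K B -> (f A `<=` f B)%fset = (A `<=` B)%fset.
Proof.
by case: isof => _ h KA KB; apply/idP/idP => /(h _ _ KA KB).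
Qed.

Lemma iso0 : f fset0 = fset0.
Proof.
have [K0 _] := cK; have [L0 _] := cL; have [A KA E] := iso_surj L0.
by apply/eqP; rewrite -fsubset0 -E iso_sub.
Qed.

(** Vertices are the atoms of the face poset: a vertex y of the image spans a face, whose preimage
    is a nonempty face of the vertex x. *)
Lemma iso_vertex x : K [fset x]%fset -> exists y, f [fset x]%fset = [fset y]%fset.
Proof.
move=> Kx; have [K0 _] := cK.
have /fset0Pn[y yf] : f [fset x]%fset != fset0.
  apply/eqP => E; have := iso_inj Kx K0; rewrite E iso0 => /(_ erefl)/fsetP/(_ x).
  by rewrite !inE eqxx.
have ysub : ([fset y] `<=` f [fset x])%fset by rewrite fsub1set.
have [B KB E] := iso_surj (face cL (iso_fun Kx) ysub).
move: ysub; rewrite -E iso_sub // fsubset1 => /orP[/eqP EB|/eqP EB].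
  by exists y; rewrite -EB.
by have := congr1 (fun X : {fset V'} => y \in X) E; rewrite EB iso0 !inE eqxx.
Qed.

Lemma iso_mem A y : K A ->
  y \in f A <-> exists2 x, x \in A & f [fset x]%fset = [fset y]%fset.
Proof.
move=> KA; split=> [yA|[x xA E]]; last first.
  have xsub : ([fset x] `<=` A)%fset by rewrite fsub1set.
  by rewrite -fsub1set -E iso_sub //; apply: face cK KA xsub.
have ysub : ([fset y] `<=` f A)%fset by rewrite fsub1set.
have [B KB E] := iso_surj (face cL (iso_fun KA) ysub).
have [] := eqVneq B fset0.
  by move=> B0; have := congr1 (fun X : {fset V'} => y \in X) E; rewrite B0 iso0 !inE eqxx.
case/fset0Pn=> x xB; exists x.
  by move: ysub; rewrite -E iso_sub // => /fsubsetP; apply.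
have xsub : ([fset x] `<=` B)%fset by rewrite fsub1set.
have Kx := face cK KB xsub; have [z Ez] := iso_vertex Kx.
by move: xsub; rewrite -(iso_sub Kx KB) E Ez fsub1set inE => /eqP->.
Qed.

Lemma iso_fset1U x A : K (x |` A)%fset -> f (x |` A)%fset = (f [fset x] `|` f A)%fset.
Proof.
move=> KxA; have KA := face cK KxA (fsubsetU1 x A).
have Kx : K [fset x]%fset by apply: face cK KxA _; rewrite fsub1set fset1U1.
apply/fsetP => y; rewrite in_fsetU; apply/idP/orP.
  move/(iso_mem _ KxA) => [z + E]; rewrite in_fset1U => /orP[/eqP zx|zA].
    by left; rewrite -zx E inE.
  by right; apply/(iso_mem _ KA); exists z.
case=> h; apply/(iso_mem _ KxA).
  by move/(iso_mem _ Kx): h => [z]; rewrite inE => /eqP-> E; exists x => //; rewrite fset1U1.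
by move/(iso_mem _ KA): h => [z zA E]; exists z => //; rewrite in_fset1U zA orbT.
Qed.

Lemma iso_notin x A : K (x |` A)%fset -> x \notin A -> (f [fset x] `&` f A)%fset = fset0.
Proof.
move=> KxA xA; have KA := face cK KxA (fsubsetU1 x A).
have Kx : K [fset x]%fset by apply: face cK KxA _; rewrite fsub1set fset1U1.
have [y Ey] := iso_vertex Kx.
apply/fsetP => z; rewrite Ey !inE; apply/negP => /andP[/eqP-> yA].
by move: xA; rewrite -fsub1set -iso_sub // Ey fsub1set yA.
Qed.

(** Recovers the image of a vertex from those of a simplex and its opposite face, so agreement on a
    chamber and a panel extends to the remaining vertex. *)
Lemma iso_vertexE x A : K (x |` A)%fset -> x \notin A ->
  f [fset x]%fset = (f (x |` A) `\` f A)%fset.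
Proof.
move=> KxA xA; rewrite iso_fset1U // fsetDUl fsetDv fsetU0.
by apply/esym/fsetDidPl; rewrite -fsetI_eq0 iso_notin.
Qed.

Lemma iso_card A : K A -> #|` f A| = #|` A|.
Proof.
elim/finSet_rect: A => A IH KA.
have [->|/fset0Pn[x xA]] := eqVneq A fset0; first by rewrite iso0.
have E : A = (x |` (A `\ x))%fset by rewrite fsetD1K.
have xN : x \notin (A `\ x)%fset by rewrite !inE eqxx.
have pA : (A `\ x `<` A)%fset by rewrite fproperD1.
have KA' := face cK KA (fproper_sub pA).
have KE : K (x |` (A `\ x))%fset by rewrite -E.
have Kx : K [fset x]%fset by apply: face cK KA _; rewrite fsub1set.
have [y Ey] := iso_vertex Kx.
have := cardfsUI (f [fset x]%fset) (f (A `\ x)%fset).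
rewrite iso_notin // -iso_fset1U // -E cardfs0 addn0 (IH _ pA KA') Ey cardfs1 => ->.
by rewrite add1n -card_fsetD1.
Qed.

Lemma iso_chamber A : K A -> chamber L (f A) <-> chamber K A.
Proof.
move=> KA; split=> [[_ h]|[_ h]]; split=> //.
- move=> B KB AB; apply: iso_inj => //; apply: h; rewrite ?iso_sub //.
  exact: iso_fun.
- exact: iso_fun.
- by move=> B /iso_surj[A' KA' <-]; rewrite iso_sub // => /(h _ KA') ->.
Qed.

Lemma iso_panel A : K A -> panel L (f A) <-> panel K A.
Proof.
move=> KA; split=> [[C' hC']|[C hC [AC card]]].
  have [C KC EC] := iso_surj (chamber_simplex hC').
  rewrite -EC !iso_card // iso_sub // => -[AC card].
  by exists C => //; apply/iso_chamber; rewrite ?EC.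
exists (f C); first by apply/iso_chamber => //; apply: chamber_simplex hC.
by rewrite !iso_card ?iso_sub //; apply: chamber_simplex hC.
Qed.

Lemma iso_adjacent C D : K C -> K D -> adjacent L (f C) (f D) <-> adjacent K C D.
Proof.
move=> KC KD; split=> [[hC hD CneD [P' pP']]|[hC hD CneD [P pP [PC PD]]]].
  have [C' hC' [PC' _]] := pP'.
  have [P KP EP] := iso_surj (face cL (chamber_simplex hC') PC').
  rewrite -EP !iso_sub // => PCD.
  split; [exact/iso_chamber|exact/iso_chamber|by move=> E; apply: CneD; rewrite E|].
  by exists P => //; apply/iso_panel; rewrite ?EP.
have KP := face cK KC PC.
split; [exact/iso_chamber|exact/iso_chamber|by move/iso_inj => /(_ KC KD)|].
by exists (f P); [apply/iso_panel|rewrite !iso_sub].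
Qed.

Lemma iso_inverse : exists g, [/\ simplicial_iso L K g,
  forall A, K A -> g (f A) = A & forall B, L B -> f (g B) = B].
Proof.
pose g B := xget fset0 [set A | K A /\ f A = B].
have gf A : K A -> g (f A) = A.
  by move=> KA; apply: xget_unique => // B [KB /iso_inj]; apply.
have fg B : L B -> f (g B) = B.
  by move=> /iso_surj[A KA <-]; rewrite gf.
have Kg B : L B -> K (g B) by move=> /iso_surj[A KA <-]; rewrite gf.
exists g; split=> //; split; first split.
- by move=> B /Kg.
- by move=> A B; rewrite !inE => LA LB E; rewrite -(fg A) // E fg.
- by move=> A KA; exists (f A); [apply: iso_fun|rewrite gf].
- by move=> A B LA LB; rewrite -{1}(fg A) // -{1}(fg B) // iso_sub //; apply: Kg.
Qed.

End Isomorphisms.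

Lemma iso_id (V : choiceType) (K : set {fset V}) : simplicial_iso K K id.
Proof. by split=> //; split=> // A KA; exists A. Qed.

Lemma iso_comp (V1 V2 V3 : choiceType) (K1 : set {fset V1}) (K2 : set {fset V2})
    (K3 : set {fset V3}) f g :
  simplicial_iso K1 K2 f -> simplicial_iso K2 K3 g -> simplicial_iso K1 K3 (g \o f).
Proof.
move=> hf hg; split; first split.
- by move=> A /(iso_fun hf)/(iso_fun hg).
- move=> A B; rewrite !inE => KA KB /= /(iso_inj hg)/(iso_inj hf).
  by apply=> //; apply: iso_fun hf _ _.
- by move=> C /(iso_surj hg)[B /(iso_surj hf)[A KA <-] <-]; exists A.
- by move=> A B KA KB /=; rewrite (iso_sub hg) ?(iso_sub hf) //; apply: iso_fun hf _ _.
Qed.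

(** * Group coordinates on Coxeter complexes *)

Section Charts.
Local Open Scope group_scope.
Variables (V : choiceType) (Sigma : set {fset V}) (W : groupType) (S : set W).
Implicit Types (A C D E P : {fset V}).

(** Replaces the poset isomorphism with the Coxeter complex by coordinates on chambers: crossing a
    panel is right multiplication by a generator, and the chambers around a simplex form a standard
    coset. *)
Record chart (delta : {fset V} -> W) : Prop := Chart {
  chart_coxeter : coxeter_system S;
  chart_inj : forall C D, chamber Sigma C -> chamber Sigma D ->
    delta C = delta D -> C = D;
  chart_surj : forall w, exists2 C, chamber Sigma C & delta C = w;
  chart_panel : forall C P, chamber Sigma C -> (P `<=` C)%fset ->
    #|` C| = #|` P|.+1 -> exists2 s, S s & forall D, chamber Sigma D ->
      (P `<=` D)%fset <-> delta D = delta C \/ delta D = delta C * s;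
  chart_edge : forall C D, chamber Sigma C -> chamber Sigma D ->
    S ((delta C)^-1 * delta D) ->
    exists P, [/\ (P `<=` C)%fset, (P `<=` D)%fset & #|` C| = #|` P|.+1];
  chart_face : forall A, Sigma A -> exists J w, J `<=` S /\
    forall D, chamber Sigma D -> (A `<=` D)%fset <-> generated J (w^-1 * delta D) }.

Lemma mem_coset (J : set W) (w x : W) :
  [set w * y | y in generated J] x <-> generated J (w^-1 * x).
Proof.
split=> [[y Jy <-]|Jx]; first by rewrite mulKg.
by exists (w^-1 * x) => //; rewrite mulVKg.
Qed.

(** Under reverse inclusion, chambers correspond to singleton cosets, whose element is the
    coordinate, and panels to cosets of the form {w, w s}. *)
Lemma chart_exists : simplicial_complex Sigma -> coxeter_system S ->
  iso_coxeter_complex S Sigma -> exists delta, chart delta.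
Proof.
move=> cS HS [g [gfun ginj gsurj] gsub]; have iS := coxeter_involutions HS.
have sc1 w : standard_coset S [set w].
  exists w, set0; split; first by move=> ? [].
  apply/seteqP; split=> [_ ->|x /mem_coset].
    by apply/mem_coset; rewrite mulVg; apply: generated1.
  by rewrite generated0 => /mulg1_eq; rewrite invgK => ->.
have sc2 w s : S s -> standard_coset S [set w; w * s].
  move=> Ss; exists w, [set s]; split; first by move=> _ ->.
  rewrite generated_involution ?iS //.
  apply/seteqP; split=> [x [->|->]|x [y [->|->] <-]].
  - by exists 1; [left|rewrite mulg1].
  - by exists s; [right|].
  - by left; rewrite mulg1.
  - by right.
have gne A : Sigma A -> exists w, g A w.
  move=> /gfun[w [J [_ ->]]]; exists w; apply/mem_coset; rewrite mulVg.
  exact: generated1.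
have gI A B : Sigma A -> Sigma B -> g A = g B -> A = B.
  by move=> SA SB; apply: ginj; rewrite inE.
have ch1 C w : Sigma C -> g C = [set w] -> chamber Sigma C.
  move=> SC EC; split=> // D SD /(gsub _ _ SC SD) sub; apply: gI => //.
  apply/seteqP; split=> // x; rewrite EC => ->.
  by have [y gy] := gne _ SD; have := sub _ gy; rewrite EC => <-.
have ch2 C : chamber Sigma C -> exists w, g C = [set w].
  move=> [SC maxC]; have [w gw] := gne _ SC.
  have [D SD ED] := gsurj _ (sc1 w).
  exists w; rewrite -ED; congr g; apply/esym/maxC => //; apply/gsub => //.
  by rewrite ED => _ ->.
pose delta C := xget 1 [set w | g C = [set w]].
have gd C : chamber Sigma C -> g C = [set delta C].
  by move=> /ch2 ex; apply: (xgetPex 1 ex).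
have fd A C : Sigma A -> chamber Sigma C ->
    (A `<=` C)%fset <-> g A (delta C).
  move=> SA hC; have SC := chamber_simplex hC; rewrite gsub // gd //.
  by split=> [|h _ ->//]; apply.
exists delta; split=> //.
- move=> C D hC hD E; apply: gI; try exact: chamber_simplex.
  by rewrite !gd // E.
- move=> w; have [C SC EC] := gsurj _ (sc1 w).
  exists C; first exact: ch1 EC.
  have := gd _ (ch1 _ _ SC EC); rewrite EC => /seteqP[h _].
  by rewrite -(h w).
- move=> C P hC PC card; have SC := chamber_simplex hC.
  have SP := face cS SC PC.
  have [w [J [JS EP]]] := gfun _ SP.
  have gC : g P (delta C) by apply/(fd _ _ SP hC).
  have wC : generated J (w^-1 * delta C) by apply/mem_coset; rewrite -EP.
  have gPs s : J s -> g P (delta C * s).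
    move=> Js; rewrite EP; apply/mem_coset; rewrite mulgA.
    by apply: generatedM => //; apply: sub_generated.
  (* If J were empty, the coset of P would be a singleton and P would equal C. *)
  have [s Js] : exists s, J s.
    apply: contrapT => nJ; have J0 : J = set0.
      by apply/seteqP; split=> // x Jx; case: nJ; exists x.
    suff E : P = C by move: card; rewrite E; lia.
    apply: gI => //; rewrite (gd C hC); apply/seteqP; split=> [x|x -> //].
    rewrite EP => /mem_coset Jx.
    have := generatedM (generatedV wC) Jx.
    rewrite invgM invgK -mulgA mulVKg J0 generated0 => /mulg1_eq.
    by rewrite invgK => ->.
  have Ss := JS _ Js; exists s => //.
  (* The simplex Q of this two-element coset lies between P and C and differs from C; as P has
     codimension 1, it is P. *)
  have [Q SQ EQ] := gsurj _ (sc2 (delta C) s Ss).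
  have PQ : (P `<=` Q)%fset.
    by apply/gsub => //; rewrite EQ => _ [->|->] //; apply: gPs.
  have QC : (Q `<=` C)%fset.
    by apply/gsub => //; rewrite EQ (gd C hC) => _ ->; left.
  have QneC : Q <> C.
    move=> QC'; have : g Q = [set delta C] by rewrite QC' gd.
    rewrite EQ => /seteqP[h _]; apply: (gen_neq1 HS Ss).
    by apply: (@mulgI _ (delta C)); rewrite mulg1; apply: h; right.
  have PQE : P = Q.
    apply: fsub_card_eq => //; rewrite -ltnS -card ltnNge; apply/negP => le.
    by apply: QneC; apply: fsub_card_eq.
  by move=> D hD; rewrite fd // PQE EQ.
- move=> C D hC hD; set s := _ * _ => Ss.
  have Es : delta C * s = delta D by rewrite /s mulVKg.
  have SC := chamber_simplex hC.
  have [P SP EP] := gsurj _ (sc2 (delta C) s Ss); rewrite Es in EP.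
  have PC : (P `<=` C)%fset by apply/fd => //; rewrite EP; left.
  have PD : (P `<=` D)%fset by apply/fd => //; rewrite EP; right.
  have CneD : delta D <> delta C.
    move=> E; apply: (gen_neq1 HS Ss); apply: (@mulgI _ (delta C)).
    by rewrite mulg1 Es.
  have PneC : P <> C.
    move=> E; have : g P = [set delta C] by rewrite E gd.
    by rewrite EP => /seteqP[h _]; apply: CneD; apply: h; right.
  (* The face of C opposite to a vertex x outside P contains P, so its coset is that of P or that of
     C. The second case is absurd since x belongs to C. *)
  exists P; split=> //; have [x [xC xP PQ]] := fsetD1_sub PC PneC.
  have QC : (C `\ x `<=` C)%fset by rewrite fsubD1set.
  have SQ := face cS SC QC.
  rewrite (card_fsetD1 xC); congr (_.+1); congr (#|` _|).
  have gQP := (gsub _ _ SP SQ).1 PQ; rewrite EP in gQP.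
  have gQC : g (C `\ x)%fset (delta C) by apply/fd.
  have [gQD|gQD] := lem (g (C `\ x)%fset (delta D)).
    apply: gI => //; rewrite EP; apply/seteqP; split=> // y [->|->] //.
  have /fsetP/(_ x) : (C `\ x)%fset = C.
    apply: gI => //; rewrite (gd C hC); apply/seteqP; split=> [y gy|y ->//].
    by have [->//|yD] := gQP _ gy; case: gQD; rewrite -yD.
  by rewrite !inE eqxx xC.
- move=> A SA; have [w [J [JS EA]]] := gfun _ SA; exists J, w; split=> // D hD.
  by rewrite fd // EA; split=> /mem_coset.
Qed.
End Charts.

(** * Galleries and apartments *)

Section GraphDistance.
Variables (T : Type) (e : T -> T -> Prop).
Implicit Types x y z : T.

Fixpoint walk n x y : Prop :=
  if n is m.+1 then exists2 z, e x z & walk m z y else x = y.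

Definition connected x y := exists n, walk n x y.

(** The value 0 for unconnected points is a mere convention; chambers of a chamber complex are
    always connected. *)
Definition graph_dist x y : nat :=
  if pselect (exists n, `[<walk n x y>]) is left h then ex_minn h else 0.

Lemma dist_walk x y : connected x y -> walk (graph_dist x y) x y.
Proof.
move=> [n hn]; rewrite /graph_dist; case: pselect => [h|[]].
  by case: ex_minnP => m /asboolP.
by exists n; apply/asboolP.
Qed.

Lemma dist_le n x y : walk n x y -> graph_dist x y <= n.
Proof.
move=> hn; rewrite /graph_dist; case: pselect => // h.
by case: ex_minnP => m _; apply; apply/asboolP.
Qed.

Lemma walk_cat n m x y z : walk n x y -> walk m y z -> walk (n + m) x z.
Proof.
elim: n x => [|n IH] x /=; first by move=> ->.
by move=> [u xu hu] hm; exists u => //; apply: IH.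
Qed.

Lemma dist_triangle x y z : connected x y -> connected y z ->
  graph_dist x z <= graph_dist x y + graph_dist y z.
Proof. by move=> /dist_walk h1 /dist_walk h2; apply/dist_le/walk_cat/h2. Qed.

Lemma distxx x : graph_dist x x = 0.
Proof. by apply/eqP; rewrite -leqn0; apply: (@dist_le 0). Qed.

Lemma dist_eq0 x y : connected x y -> graph_dist x y = 0 -> x = y.
Proof. by move=> /dist_walk + E; rewrite E. Qed.

Lemma dist_first_step x y : connected x y -> x <> y ->
  exists z, [/\ e x z, connected z y & graph_dist x y = (graph_dist z y).+1].
Proof.
move=> cxy xy; have := dist_walk cxy; case E: (graph_dist x y) => [|n] //= [z xz hz].
exists z; split=> //; first by exists n.
apply/eqP; rewrite eqSS eqn_leq (dist_le hz) andbT -ltnS -E.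
have cz : connected z y by exists n.
by apply: (@dist_le (graph_dist z y).+1); exists z => //; apply: dist_walk.
Qed.

Hypothesis esym : forall x y, e x y -> e y x.

Lemma walkC n x y : walk n x y -> walk n y x.
Proof.
elim: n x => [|n IH] x /=; first by move=> ->.
move=> [z xz /IH hz]; have: walk (n + 1) y x; last by rewrite addn1.
by apply: walk_cat hz _; exists x => //; apply: esym.
Qed.

Lemma distC x y : graph_dist x y = graph_dist y x.
Proof.
have [cxy|ncxy] := lem (connected x y).
  have cyx : connected y x by case: cxy => n /walkC; exists n.
  by apply/eqP; rewrite eqn_leq !dist_le //; apply: walkC; apply: dist_walk.
rewrite /graph_dist; case: pselect => [h|_].
  by case: ncxy; case: h => n /asboolP; exists n.
by case: pselect => // h; case: ncxy; case: h => n /asboolP /walkC; exists n.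
Qed.

End GraphDistance.

(** * Retractions and convexity of apartments *)

Section BuildingGeometry.
Variables (V : choiceType) (Delta : set {fset V}) (A : set (set {fset V})).
Hypotheses (cD : chamber_complex Delta) (tA : tits_axioms Delta A).
Implicit Types (Sigma : set {fset V}) (C D E F P Q a b : {fset V}).

Let sD : simplicial_complex Delta. Proof. by case: cD. Qed.

Lemma apt_sub Sigma : A Sigma -> Sigma `<=` Delta.
Proof. by case: tA => h _ _ _ /h[]. Qed.

Lemma apt_complex Sigma : A Sigma -> simplicial_complex Sigma.
Proof. by case: tA => h _ _ _ /h[]. Qed.

Lemma apt_chart Sigma : A Sigma ->
  exists (W : groupType) (S : set W) delta, chart Sigma S delta.
Proof.
move=> AS; case: tA => _ /(_ _ AS)[W [S [HS _ iS]]] _ _.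
by have [delta hd] := chart_exists (apt_complex AS) HS iS; exists W, S, delta.
Qed.

Lemma apt_through a b : Delta a -> Delta b ->
  exists Sigma, [/\ A Sigma, Sigma a & Sigma b].
Proof. by case: tA => _ _ h _; apply: h. Qed.

Lemma apt_iso Sigma Sigma' a b : A Sigma -> A Sigma' ->
    Sigma a -> Sigma b -> Sigma' a -> Sigma' b ->
  exists2 f, simplicial_iso Sigma Sigma' f &
    forall c, (c `<=` a)%fset \/ (c `<=` b)%fset -> f c = c.
Proof. by case: tA => _ _ _ h; apply: h. Qed.

Lemma card_chamber C D : chamber Delta C -> chamber Delta D -> #|` C| = #|` D|.
Proof. by case: cD => _ _ h _; apply: h. Qed.

Lemma in_chamber a : Delta a -> exists2 C, chamber Delta C & (a `<=` C)%fset.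
Proof. by case: cD => _ fd _ _ /(sub_chamber fd). Qed.

(** If a chamber E of [Delta] contains C, an apartment through both is isomorphic to Sigma by a map
    fixing C. So C is maximal there and equals E. *)
Lemma apt_chamber Sigma C : A Sigma -> chamber Sigma C -> chamber Delta C.
Proof.
move=> AS hC; have SC := chamber_simplex hC; have DC := apt_sub AS SC.
have [E hE CE] := in_chamber DC.
have [Sigma1 [A1 S1C S1E]] := apt_through DC (chamber_simplex hE).
have [f isof fC] := apt_iso AS A1 SC SC S1C S1C.
have := (iso_chamber isof SC).2 hC; rewrite fC; last by left.
by case=> _ /(_ E S1E CE) => <-.
Qed.

Lemma chamber_apt Sigma C : A Sigma -> Sigma C -> chamber Delta C -> chamber Sigma C.
Proof. by move=> AS SC [_ h]; split=> // D /(apt_sub AS); apply: h. Qed.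

Lemma in_apt_chamber Sigma a : A Sigma -> Sigma a ->
  exists2 C, chamber Sigma C & (a `<=` C)%fset.
Proof.
move=> AS; apply: sub_chamber; case: cD => _ [n hn] _ _.
by exists n => B /(apt_sub AS); apply: hn.
Qed.

Lemma panel_card P C : panel Delta P -> chamber Delta C -> #|` C| = #|` P|.+1.
Proof. by move=> [D hD [_ <-]] hC; apply: card_chamber. Qed.

Lemma adjacent_panel C D : chamber Delta C -> chamber Delta D -> C <> D ->
  adjacent Delta C D <-> exists P, [/\ (P `<=` C)%fset, (P `<=` D)%fset & #|` C| = #|` P|.+1].
Proof.
move=> hC hD CD; split=> [[_ _ _ [P pP [PC PD]]]|[P [PC PD card]]].
  by exists P; split=> //; apply: panel_card.
by split=> //; exists P => //; exists C.
Qed.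

Lemma adjacent_cap C D : adjacent Delta C D -> #|` C| = #|` (C `&` D)%fset|.+1.
Proof.
move=> [hC hD CD [P pP [PC PD]]]; have card := panel_card pP hC.
by rewrite -(panel_cap PC PD CD card (card_chamber hC hD)).
Qed.

Lemma panel_adjacent C D P : chamber Delta C -> chamber Delta D -> C <> D ->
  (P `<=` C)%fset -> (P `<=` D)%fset -> #|` C| = #|` P|.+1 -> adjacent Delta C D.
Proof. by move=> hC hD CD PC PD card; apply/adjacent_panel => //; exists P. Qed.

Lemma chart_adjacent Sigma (W : groupType) (S : set W) delta C D :
    A Sigma -> chart Sigma S delta -> chamber Sigma C -> chamber Sigma D ->
  adjacent Delta C D <-> S ((delta C)^-1 * delta D)%g.
Proof.
move=> AS ch hC hD; have HS := chart_coxeter ch.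
have hC' := apt_chamber AS hC; have hD' := apt_chamber AS hD; split.
  move=> [_ _ CD [P pP [PC PD]]].
  have [s Ss /(_ D hD)[/(_ PD) + _]] := chart_panel ch hC PC (panel_card pP hC').
  by case=> [/(chart_inj ch hD hC)/esym/CD//|->]; rewrite mulKg.
move=> Ss; have [P [PC PD card]] := chart_edge ch hC hD Ss.
apply: (panel_adjacent _ _ _ PC PD) => // E.
by apply: (gen_neq1 HS Ss); rewrite E mulVg.
Qed.

(** Apartments are thin: in coordinates, a panel of C lies only in the chambers at delta C and delta
    C s. *)
Lemma apt_thin Sigma C D E P : A Sigma ->
    chamber Sigma C -> chamber Sigma D -> chamber Sigma E ->
    (P `<=` C)%fset -> (P `<=` D)%fset -> (P `<=` E)%fset ->
    #|` C| = #|` P|.+1 -> D <> C -> E <> C -> D = E.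
Proof.
move=> AS hC hD hE PC PD PE card DC EC; have [W [S [delta ch]]] := apt_chart AS.
have [s Ss hs] := chart_panel ch hC PC card.
have [/(chart_inj ch hD hC)/DC//|dD] := (hs _ hD).1 PD.
have [/(chart_inj ch hE hC)/EC//|dE] := (hs _ hE).1 PE.
by apply: (chart_inj ch) => //; rewrite dD.
Qed.

Lemma apt_other Sigma C P : A Sigma -> chamber Sigma C -> (P `<=` C)%fset ->
  #|` C| = #|` P|.+1 -> exists D, [/\ chamber Sigma D, (P `<=` D)%fset & D <> C].
Proof.
move=> AS hC PC card; have [W [S [delta ch]]] := apt_chart AS.
have [s Ss hs] := chart_panel ch hC PC card.
have [D hD dD] := chart_surj ch (delta C * s)%g; exists D; split=> //.
  by apply/hs => //; right.
move=> E; apply: (gen_neq1 (chart_coxeter ch) Ss).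
by apply: (@mulgI _ (delta C)); rewrite mulg1 -dD E.
Qed.

Section Rigidity.
Variables (Sigma Sigma' : set {fset V}) (f h : {fset V} -> {fset V}).
Hypotheses (AS : A Sigma) (AS' : A Sigma').
Hypotheses (isof : simplicial_iso Sigma Sigma' f) (isoh : simplicial_iso Sigma Sigma' h).
Let cS := apt_complex AS.
Let cS' := apt_complex AS'.

(** By thinness both maps send D to the only other chamber on the image of the common panel. They
    then agree on the vertex of D off that panel, hence on every face of D. *)
Lemma rigid_step C D : chamber Sigma C -> chamber Sigma D -> adjacent Delta C D ->
    (forall a, (a `<=` C)%fset -> f a = h a) ->
  forall a, (a `<=` D)%fset -> f a = h a.
Proof.
move=> hC hD adj fh; have [hC' hD' CD [P pP [PC PD]]] := adj.
have cardC := panel_card pP hC'; have cardD := panel_card pP hD'.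
have SC := chamber_simplex hC; have SD := chamber_simplex hD.
have SP := face cS SC PC.
have fP := fh _ PC; have fC := fh _ (fsubset_refl C).
have fD : f D = h D.
  apply: (@apt_thin Sigma' (f C) _ _ (f P)) => //.
  - exact/(iso_chamber isof).
  - exact/(iso_chamber isof).
  - exact/(iso_chamber isoh).
  - by rewrite (iso_sub isof).
  - by rewrite (iso_sub isof).
  - by rewrite fP (iso_sub isoh).
  - by rewrite !(iso_card cS cS' isof).
  - by move/(iso_inj isof) => /(_ SD SC) /esym.
  - by rewrite fC => /(iso_inj isoh) => /(_ SD SC) /esym.
have [x [xD xP EP]] := panel_fsetD1 PD cardD.
have ED : D = (x |` P)%fset by rewrite EP fsetD1K.
have fx : f [fset x]%fset = h [fset x]%fset.
  rewrite ED in SD fD.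
  by rewrite (iso_vertexE cS cS' isof SD xP) (iso_vertexE cS cS' isoh SD xP) fD fP.
have fhx y : y \in D -> f [fset y]%fset = h [fset y]%fset.
  rewrite {1}ED in_fset1U => /orP[/eqP->//|yP].
  by apply: fh; rewrite fsub1set; apply: (fsubsetP PC).
move=> a aD; have Sa := face cS SD aD; apply/fsetP => y; apply/idP/idP.
  move=> /(iso_mem cS cS' isof _ Sa)[z za Ez]; apply/(iso_mem cS cS' isoh _ Sa).
  by exists z => //; rewrite -fhx //; apply: (fsubsetP aD).
move=> /(iso_mem cS cS' isoh _ Sa)[z za Ez]; apply/(iso_mem cS cS' isof _ Sa).
by exists z => //; rewrite fhx //; apply: (fsubsetP aD).
Qed.

Lemma rigid C : chamber Sigma C -> (forall a, (a `<=` C)%fset -> f a = h a) ->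
  forall a, Sigma a -> f a = h a.
Proof.
move=> hC fh; have [W [S [delta ch]]] := apt_chart AS.
have HS := chart_coxeter ch.
have key ws : word S ws -> forall C, chamber Sigma C ->
    (forall a, (a `<=` C)%fset -> f a = h a) -> forall D, chamber Sigma D ->
    delta D = (delta C * wprod ws)%g -> forall a, (a `<=` D)%fset -> f a = h a.
  elim: ws => [|s ws IH] /= hw {hC}{}C hC {}fh D hD.
    by rewrite mulg1 => /(chart_inj ch hD hC) ->.
  have [Ss hws] := (word_cons _ _ _).1 hw.
  have [E hE dE] := chart_surj ch (delta C * s)%g.
  rewrite mulgA -dE; apply: IH => //; apply: (rigid_step hC hE _ fh).
  by apply/(chart_adjacent AS ch hC hE); rewrite dE mulKg.
move=> a Sa; have [D hD aD] := in_apt_chamber AS Sa.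
have [ws [hws Ews _]] := len_word HS ((delta C)^-1 * delta D)%g.
by apply: (key ws hws C hC fh D hD) => //; rewrite Ews mulVKg.
Qed.

End Rigidity.

(** The retraction onto Sigma centred at E moves a simplex by an isomorphism, fixing the faces of E,
    from an apartment through both onto Sigma. The last clause says that no other chamber is folded
    onto E and that faces shared with E are kept. *)
Lemma retraction Sigma E : A Sigma -> chamber Sigma E -> exists rho, [/\
  forall D, chamber Delta D -> chamber Sigma (rho D),
  forall D, chamber Sigma D -> rho D = D,
  forall C D, adjacent Delta C D -> rho C = rho D \/ adjacent Delta (rho C) (rho D)
  & forall D P, chamber Delta D -> D <> E -> (P `<=` E)%fset -> (P `<=` D)%fset ->
      (P `<=` rho D)%fset /\ rho D <> E].
Proof.
move=> AS hE; have SE := chamber_simplex hE; have hE' := apt_chamber AS hE.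
pose r a b := exists Sigma1 f, [/\ A Sigma1, Sigma1 E & Sigma1 a] /\
  [/\ simplicial_iso Sigma1 Sigma f, forall c, (c `<=` E)%fset -> f c = c & f a = b].
have r_ex a : exists b, Delta a -> r a b.
  have [Da|nDa] := lem (Delta a); last by exists fset0.
  have [Sigma1 [A1 S1E S1a]] := apt_through (chamber_simplex hE') Da.
  have [f isof fE] := apt_iso A1 AS S1E S1E SE SE.
  by exists (f a) => _; exists Sigma1, f; split; split=> // c cE; apply: fE; left.
have [rho rhoP] := choice r_ex.
have r_fun a b b' : r a b -> r a b' -> b = b'.
  move=> [Sigma1 [f [[A1 S1E S1a] [isof fE <-]]]].
  move=> [Sigma2 [h [[A2 S2E S2a] [isoh hE2 <-]]]].
  (* An isomorphism k fixing E and a links the two apartments; by rigidity, composing it with h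
     gives f, so both send a to the same simplex. *)
  have [k isok kE] := apt_iso A1 A2 S1E S1a S2E S2a.
  have hE1 := chamber_apt A1 S1E hE'.
  have := rigid A1 AS isof (iso_comp isok isoh) hE1 _ S1a.
  rewrite /= (kE a); last by right.
  by apply=> c cE; rewrite kE ?fE ?hE2 //; left.
have rhoE a Sigma1 f : A Sigma1 -> Sigma1 E -> Sigma1 a ->
    simplicial_iso Sigma1 Sigma f -> (forall c, (c `<=` E)%fset -> f c = c) -> rho a = f a.
  move=> A1 S1E S1a isof fE; apply: r_fun (rhoP a (apt_sub A1 S1a)) _.
  by exists Sigma1, f.
have rho_data a b : Delta a -> (b `<=` a)%fset -> exists Sigma1 f,
    [/\ A Sigma1, Sigma1 E & Sigma1 a] /\ [/\ simplicial_iso Sigma1 Sigma f,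
    forall c, (c `<=` E)%fset -> f c = c, rho a = f a & rho b = f b].
  move=> Da ba; have [Sigma1 [f [[A1 S1E S1a] [isof fE fa]]]] := rhoP _ Da.
  exists Sigma1, f; split; split=> //.
  by apply: (rhoE _ Sigma1) => //; apply: face (apt_complex A1) S1a ba.
have rho_ch D : chamber Delta D -> chamber Sigma (rho D).
  move=> hD; have [Sigma1 [f [[A1 S1E S1a] [isof fE -> _]]]] :=
    rho_data _ _ (chamber_simplex hD) (fsubset_refl D).
  by apply/(iso_chamber isof) => //; apply: chamber_apt.
have rho_face D P : chamber Delta D -> (P `<=` D)%fset ->
    (rho P `<=` rho D)%fset /\ #|` rho P| = #|` P|.
  move=> hD PD; have [Sigma1 [f [[A1 S1E S1a] [isof fE -> ->]]]] :=
    rho_data _ _ (chamber_simplex hD) PD.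
  have S1P := face (apt_complex A1) S1a PD.
  by rewrite (iso_sub isof) // (iso_card (apt_complex A1) (apt_complex AS) isof).
exists rho; split=> //.
- move=> D hD; apply: (rhoE D Sigma id) => //; [exact: chamber_simplex|exact: iso_id].
- move=> C D [hC hD _ [P pP [PC PD]]].
  have [/rho_ch hC' /rho_ch hD'] := (hC, hD).
  have [PC' cardP] := rho_face _ _ hC PC; have [PD' _] := rho_face _ _ hD PD.
  have [->|ne] := lem (rho C = rho D); [by left|right].
  have dC := apt_chamber AS hC'.
  apply: panel_adjacent PC' PD' _ => //; first exact: apt_chamber AS hD'.
  by rewrite cardP; apply: panel_card.
- move=> D P hD DE PE PD.
  have [Sigma1 [f [[A1 S1E S1a] [isof fE -> fP]]]] :=
    rho_data _ _ (chamber_simplex hD) PD.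
  split.
    rewrite -{1}(fE P PE) (iso_sub isof) //.
    exact: face (apt_complex A1) S1E PE.
  by rewrite -{1}(fE E (fsubset_refl E)) => /(iso_inj isof) => /(_ S1a S1E).
Qed.

Local Notation dist := (graph_dist (adjacent Delta)).

Lemma chamber_connected C D : chamber Delta C -> chamber Delta D ->
  connected (adjacent Delta) C D.
Proof.
move=> hC hD; case: cD => _ _ _ /(_ C D hC hD).
elim=> [x y xy|x|x y z _ [n h1] _ [m h2]].
- by exists 1; exists y.
- by exists 0.
- by exists (n + m); apply: walk_cat h1 h2.
Qed.
Local Notation conn := chamber_connected.

Lemma gdistC C D : dist C D = dist D C.
Proof. by apply: distC => ? ?; apply: adjacentC. Qed.

Lemma gdist_triangle C D E : chamber Delta C -> chamber Delta D -> chamber Delta E ->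
  dist C E <= dist C D + dist D E.
Proof. by move=> hC hD hE; apply: dist_triangle; apply: conn. Qed.

Lemma gdist_eq0 C D : chamber Delta C -> chamber Delta D -> dist C D = 0 -> C = D.
Proof. by move=> hC hD; apply/dist_eq0/conn. Qed.

Lemma adjacent_dist C D : adjacent Delta C D -> dist C D = 1%N.
Proof.
move=> adj; have [hC hD CD _] := adj.
have : dist C D <= 1 by apply: dist_le; exists D.
by case E: (dist C D) => [|[|//]] // _; case: CD; apply: gdist_eq0.
Qed.

Lemma dist_adjacent C D : chamber Delta C -> chamber Delta D ->
  dist C D = 1%N -> adjacent Delta C D.
Proof. by move=> hC hD E; have := dist_walk (conn hC hD); rewrite E => -[x + <-]. Qed.

Lemma gdist_first_step C D : chamber Delta C -> chamber Delta D -> C <> D ->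
  exists2 E, adjacent Delta C E & dist C D = (dist E D).+1.
Proof. by move=> hC hD CD; have [E [? _ ?]] := dist_first_step (conn hC hD) CD; exists E. Qed.

(** If E were outside Sigma, let F be the other chamber of Sigma on the panel of C and E. The
    retraction centred at F sends E to C, fixes D and lengthens no gallery, so D would be as close
    to C as to E. *)
Lemma apt_convex_step Sigma C D E : A Sigma -> chamber Sigma C -> chamber Sigma D ->
  adjacent Delta C E -> dist C D = (dist E D).+1 -> chamber Sigma E.
Proof.
move=> AS hC hD adj Edist; have [hC' hE CE [P pP [PC PE]]] := adj.
have hD' := apt_chamber AS hD.
apply: contrapT => nE; have card := panel_card pP hC'.
have [F [hF PF FC]] := apt_other AS hC PC card.
have [rho [rho_ch rho_id rho_adj rho_F]] := retraction AS hF.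
have [|PrE rEF] := rho_F E P hE _ PF PE; first by move=> EF; apply: nE; rewrite EF.
have rE : rho E = C.
  apply/esym/(@apt_thin Sigma F _ _ P) => //; first exact: rho_ch.
    by apply: panel_card pP (apt_chamber AS hF).
  exact/nesym.
have lip n X Y : walk (adjacent Delta) n X Y ->
    exists2 m, m <= n & walk (adjacent Delta) m (rho X) (rho Y).
  elim: n X => [|n IH] X /=; first by move=> ->; exists 0.
  move=> [Z XZ /IH[m mn hm]]; have [->|XZ'] := rho_adj _ _ XZ.
    by exists m => //; apply: leqW.
  by exists m.+1 => //; exists (rho Z).
have [m mn hm] := lip _ _ _ (dist_walk (conn hE hD')).
by rewrite rE (rho_id _ hD) in hm; have := dist_le hm; lia.
Qed.

Lemma apt_convex Sigma C D E : A Sigma -> chamber Sigma C -> chamber Sigma D ->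
  chamber Delta E -> (dist C E + dist E D)%N = dist C D -> chamber Sigma E.
Proof.
move=> AS hC hD hE; move En: (dist C E) => n.
elim: n C hC En => [|n IH] C hC En Edist; have hC' := apt_chamber AS hC.
  by rewrite -(gdist_eq0 hC' hE En).
have [|F adj EF] := gdist_first_step hC' hE.
  by move=> CE; move: En; rewrite CE distxx.
have [_ hF _ _] := adj; have hD' := apt_chamber AS hD.
have := gdist_triangle hF hE hD'; have := gdist_triangle hC' hF hD'.
rewrite (adjacent_dist adj) => h1 h2.
have hFS : chamber Sigma F by apply: apt_convex_step AS hC hD adj _; lia.
by apply: (IH F hFS); lia.
Qed.

(** A reduced word gives a gallery in Sigma. Conversely, a minimal gallery stays in Sigma by
    convexity, and each of its steps contributes one generator. *)
Lemma chart_dist Sigma (W : groupType) (S : set W) delta C D :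
    A Sigma -> chart Sigma S delta -> chamber Sigma C -> chamber Sigma D ->
  dist C D = cdist S (delta C) (delta D).
Proof.
move=> AS ch hC hD; have HS := chart_coxeter ch.
have hC' := apt_chamber AS hC; have hD' := apt_chamber AS hD.
apply/eqP; rewrite eqn_leq; apply/andP; split.
  rewrite /cdist; have [ws [hws Ews <-]] := len_word HS ((delta C)^-1 * delta D)%g.
  apply: dist_le; have {Ews} : (delta C * wprod ws)%g = delta D by rewrite Ews mulVKg.
  elim: ws C hC {hC'} hws => [|s ws IH] C hC hws /=.
    by rewrite mulg1 => /(chart_inj ch hC hD).
  have [Ss hws'] := (word_cons _ _ _).1 hws.
  have [E hE dE] := chart_surj ch (delta C * s)%g.
  rewrite mulgA -dE => /(IH E hE hws') hw; exists E => //.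
  by apply/(chart_adjacent AS ch hC hE); rewrite dE mulKg.
move En: (dist C D) => n; elim: n C hC hC' En => [|n IH] C hC hC' En.
  by rewrite (gdist_eq0 hC' hD' En) /cdist mulVg len1.
have [|E adj EE] := gdist_first_step hC' hD'.
  by move=> CD; move: En; rewrite CD distxx.
have hE := apt_convex_step AS hC hD adj EE.
have /(IH E hE (apt_chamber AS hE)) : dist E D = n by lia.
have /(chart_adjacent AS ch hC hE)/(len_gen HS) lE := adj.
have := lenM HS ((delta C)^-1 * delta E)%g ((delta E)^-1 * delta D)%g.
rewrite -mulgA mulVKg lE => h1 h2; apply: leq_trans h1 _; exact: h2.
Qed.

Lemma apt_parity Sigma C D E : A Sigma -> chamber Sigma C -> chamber Sigma D ->
    chamber Sigma E -> adjacent Delta D E ->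
  dist C E = (dist C D).+1 \/ dist C D = (dist C E).+1.
Proof.
move=> AS hC hD hE; have [W [S [delta ch]]] := apt_chart AS.
have HS := chart_coxeter ch.
move=> /adjacentC/(chart_adjacent AS ch hE hD) Ss.
rewrite !(chart_dist AS ch) // !(cdistC HS (delta C)) /cdist.
have := len_genM HS ((delta D)^-1 * delta C)%g Ss.
by rewrite -mulgA mulVKg.
Qed.

End BuildingGeometry.

(** * Maps preserving apartments *)

(** Two simplices lie in two chambers, and these in a common member of A. The other axioms are
    inherited from the complete system. *)
Lemma apartment_system_tits (V : choiceType) (Delta : set {fset V}) A :
  chamber_complex Delta -> apartment_system Delta A -> tits_axioms Delta A.
Proof.
move=> cD [Ac [[t1 t2 t3 t4] _] [AAc cov]].
split=> [Sigma /AAc/t1//|Sigma /AAc/t2//|a b Da Db|Sigma Sigma' a b /AAc AS /AAc AS'].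
  have [[C hC aC] [D hD bD]] := (in_chamber cD Da, in_chamber cD Db).
  have [Sigma [AS SC SD]] := cov _ _ hC hD.
  have [_ cS] := t1 _ (AAc _ AS).
  by exists Sigma; split=> //; [apply: face cS SC aC|apply: face cS SD bD].
exact: t4.
Qed.

Lemma apt_through_chambers (V : choiceType) (Delta : set {fset V}) A C D :
    tits_axioms Delta A -> chamber Delta C -> chamber Delta D ->
  exists Sigma, [/\ A Sigma, chamber Sigma C & chamber Sigma D].
Proof.
move=> tA hC hD.
have [Sigma [AS SC SD]] := apt_through tA (chamber_simplex hC) (chamber_simplex hD).
by exists Sigma; split=> //; apply: (chamber_apt tA).
Qed.

Section ThickBuilding.
Variables (V : choiceType) (Delta : set {fset V}) (A : set (set {fset V})).
Hypotheses (cD : chamber_complex Delta) (tA : tits_axioms Delta A).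
Hypothesis thickD : thick Delta.
Local Notation dist := (graph_dist (adjacent Delta)).

Lemma thick_third C D P : panel Delta P -> exists E,
  [/\ chamber Delta E, E <> C, E <> D & (P `<=` E)%fset].
Proof.
move=> /thickD[C1 [C2 [C3 [[h1 h2 h3] [[n12 n13 n23] [P1 P2 P3]]]]]].
have [e1|n1] := lem (C1 = C \/ C1 = D); last first.
  by exists C1; split=> // e; apply: n1; [left|right].
have [e2|n2] := lem (C2 = C \/ C2 = D); last first.
  by exists C2; split=> // e; apply: n2; [left|right].
by exists C3; split=> //; case: e1 => ?; case: e2 => ?; congruence.
Qed.

Lemma thick_separation C D E : chamber Delta C -> adjacent Delta D E ->
    dist C E = (dist C D).+1 ->
  exists Sigma, [/\ A Sigma, chamber Sigma C, chamber Sigma D & ~ chamber Sigma E].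
Proof.
move=> hC adj EDE; have [hD hE DE [P pP [PD PE]]] := adj.
have [F [hF FD FE PF]] := thick_third D E pP.
have cardD := panel_card cD pP hD; have cardE := panel_card cD pP hE.
have cardF := panel_card cD pP hF.
have adjDF : adjacent Delta D F.
  exact: (panel_adjacent cD hD hF (nesym FD) PD PF cardD).
have adjFE := panel_adjacent cD hF hE FE PF PE cardF.
have dDE := adjacent_dist cD adj; have dDF := adjacent_dist cD adjDF.
have dFE := adjacent_dist cD adjFE.
have dF : dist C F = (dist C D).+1.
  have := gdist_triangle cD hC hF hE; have := gdist_triangle cD hC hD hF.
  rewrite dDF dFE => h1 h2.
  suff : dist C F <> dist C D by lia.
  (* Otherwise D and F both lie on minimal galleries from C to E, and an apartment through C and E
     would contain three chambers on P. *)
  move=> EF; have [Sigma [AS SC SE]] := apt_through_chambers tA hC hE.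
  have SD : chamber Sigma D by apply: (apt_convex cD tA AS SC SE hD); lia.
  have SF : chamber Sigma F by apply: (apt_convex cD tA AS SC SE hF); lia.
  by apply: FD; apply: (apt_thin tA AS SE SF SD PE PF PD cardE).
have [Sigma [AS SC SF]] := apt_through_chambers tA hC hF.
have SD : chamber Sigma D by apply: (apt_convex cD tA AS SC SF hD); lia.
exists Sigma; split=> // SE; apply: FE.
by apply: (apt_thin tA AS SD SF SE PD PF PE cardD) => //; apply: nesym.
Qed.

(** By parity, let E be nearer to C than to D, and let F be the first step from C towards E. Then F
    is farther from D than C is, so some apartment contains D and C but not F; by convexity it
    cannot contain E. *)
Lemma adjacent_separation C D E Sigma : A Sigma -> chamber Sigma C -> chamber Sigma D ->
    chamber Sigma E -> adjacent Delta C D -> E <> C -> E <> D ->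
  exists Sigma', [/\ A Sigma', chamber Sigma' C, chamber Sigma' D & ~ chamber Sigma' E].
Proof.
move=> AS SC SD SE.
wlog Edist : C D SC SD / dist E D = (dist E C).+1.
  move=> th adj EC ED; have [h|h] := apt_parity cD tA AS SE SC SD adj.
    exact: th.
  have [Sigma1 [? ? ? ?]] := th D C SD SC h (adjacentC adj) ED EC.
  by exists Sigma1; split.
move=> adj EC ED.
have [hC hD hE] := And3 (apt_chamber cD tA AS SC) (apt_chamber cD tA AS SD) (apt_chamber cD tA AS SE).
have [|F adjCF EF] := gdist_first_step cD hC hE; first exact/nesym.
have [_ hF _ _] := adjCF.
have dCD := adjacent_dist cD adj; have dCF := adjacent_dist cD adjCF.
have dDF : dist D F = (dist D C).+1.
  have := gdist_triangle cD hD hC hF; have := gdist_triangle cD hD hF hE.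
  by rewrite (gdistC _ D C) (gdistC _ D E) Edist (gdistC _ E C) EF dCD dCF; lia.
have [Sigma' [AS' SD' SC' nSF]] := thick_separation hD adjCF dDF.
exists Sigma'; split=> // SE'; apply: nSF.
by apply: (apt_convex cD tA AS' SC' SE' hF); rewrite dCF EF.
Qed.

End ThickBuilding.

Section ApartmentMap.
Variables (V V' : choiceType) (Delta : set {fset V}) (Delta' : set {fset V'}).
Variables (A : set (set {fset V})) (A' : set (set {fset V'})).
Hypotheses (cD : chamber_complex Delta) (tA : tits_axioms Delta A).
Hypotheses (cD' : chamber_complex Delta') (tA' : tits_axioms Delta' A').
Hypothesis thickD : thick Delta.
Variable phi : {fset V} -> {fset V'}.
Hypothesis phi_ch : forall C, chamber Delta C -> chamber Delta' (phi C).
Hypothesis phi_apt : forall Sigma, A Sigma -> exists2 Sigma', A' Sigma' &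
  set_bij (chamber Sigma) (chamber Sigma') phi.
Local Notation dist := (graph_dist (adjacent Delta)).
Local Notation dist' := (graph_dist (adjacent Delta')).

Lemma phi_inj C D : chamber Delta C -> chamber Delta D -> phi C = phi D -> C = D.
Proof.
move=> hC hD E; have [Sigma [AS SC SD]] := apt_through_chambers tA hC hD.
by have [Sigma' _ [_ inj _]] := phi_apt AS; apply: inj; rewrite ?inE.
Qed.

Lemma phi_convex Sigma C D E' : A Sigma -> chamber Sigma C -> chamber Sigma D ->
    chamber Delta' E' -> (dist' (phi C) E' + dist' E' (phi D))%N = dist' (phi C) (phi D) ->
  exists2 E, chamber Sigma E & phi E = E'.
Proof.
move=> AS SC SD hE' E; have [Sigma' AS' [fn _ surj]] := phi_apt AS.
have SE' := apt_convex cD' tA' AS' (fn _ SC) (fn _ SD) hE' E.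
by have [F SF <-] := surj _ SE'; exists F.
Qed.

(* The apartments through C and D have only these two chambers in common; so do
   their images, whose intersection is convex. *)
Lemma phi_adjacent C D : adjacent Delta C D -> adjacent Delta' (phi C) (phi D).
Proof.
move=> adj; have [hC hD CD _] := adj.
have [hC' hD'] := (phi_ch hC, phi_ch hD).
have [|F adjF EF] := gdist_first_step cD' hC' hD'; first by move/(phi_inj hC hD).
have [_ hF CF _] := adjF; have dF := adjacent_dist cD' adjF.
have [Sigma [AS SC SD]] := apt_through_chambers tA hC hD.
have sumF : (dist' (phi C) F + dist' F (phi D))%N = dist' (phi C) (phi D).
  by rewrite dF EF.
have [E SE EF'] := phi_convex AS SC SD hF sumF; subst F.
have [ED|ED] := lem (E = D); first by rewrite -ED.
have EC : E <> C by move=> E0; apply: CF; rewrite E0.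
have hE := apt_chamber cD tA AS SE.
have [Sigma2 [AS2 SC2 SD2 []]] := adjacent_separation cD tA thickD AS SC SD SE adj EC ED.
have [E2 SE2 EE2] := phi_convex AS2 SC2 SD2 hF sumF.
by rewrite -(phi_inj (apt_chamber cD tA AS2 SE2) hE EE2).
Qed.

(** Let E precede D on a minimal gallery from C. By parity, [phi D] is one step farther from [phi C]
    than [phi E], or one step nearer. If nearer, convexity would put D in every apartment through C
    and E, against [thick_separation]. *)
Lemma phi_dist C D : chamber Delta C -> chamber Delta D ->
  dist' (phi C) (phi D) = dist C D.
Proof.
move=> hC; move En: (dist C D) => n; elim: n D En => [|n IH] D En hD.
  by rewrite -(gdist_eq0 cD hC hD En) distxx.
have [|E adjDE EE] := gdist_first_step cD hD hC.
  by move=> DC; move: En; rewrite DC distxx.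
have [_ hE _ _] := adjDE; rewrite gdistC En in EE.
have dE : dist C E = n by rewrite gdistC; lia.
have dE' := IH _ dE hE.
have adjED := adjacentC adjDE; have adj' := phi_adjacent adjED.
have [Sigma0 [AS0 SC0 SD0]] := apt_through_chambers tA hC hD.
have SE0 : chamber Sigma0 E.
  by apply: (apt_convex cD tA AS0 SC0 SD0 hE); rewrite (adjacent_dist cD adjED) dE En addn1.
have [Sigma0' AS0' [fn _ _]] := phi_apt AS0.
have [->|Ed] := apt_parity cD' tA' AS0' (fn _ SC0) (fn _ SE0) (fn _ SD0) adj'.
  by rewrite dE'.
have [|Sigma [AS SC SE []]] := thick_separation cD tA thickD hC adjED.
  by rewrite dE.
have [|F SF EF] := phi_convex AS SC SE (phi_ch hD).
  by rewrite (gdistC _ (phi D)) (adjacent_dist cD' adj') Ed addn1.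
by rewrite -(phi_inj (apt_chamber cD tA AS SF) hD EF).
Qed.

End ApartmentMap.

(* Retracting onto an apartment through C and D, centred at C, would otherwise
   give a triangle in a Coxeter complex, whose chamber graph is bipartite. *)
Lemma adjacent_triple (V : choiceType) (Delta : set {fset V}) A C D F :
    chamber_complex Delta -> tits_axioms Delta A -> adjacent Delta C D ->
    adjacent Delta C F -> adjacent Delta D F -> (C `&` D `<=` F)%fset.
Proof.
move=> cD tA CD CF DF.
have [hC hD CneD _] := CD; have [_ hF CneF _] := CF.
apply: contrapT => nsub.
have [Sigma [AS SC SD]] := apt_through_chambers tA hC hD.
have [rho [rho_ch rho_id rho_adj rho_C]] := retraction cD tA AS SC.
have [] := rho_C F (C `&` F)%fset hF (nesym CneF) (fsubsetIl _ _) (fsubsetIr _ _).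
have cardF := adjacent_cap cD CF; have cardD := adjacent_cap cD CD.
move=> QrF rFC; have SrF := rho_ch _ hF; have hrF := apt_chamber cD tA AS SrF.
have adjC := panel_adjacent cD hC hrF (nesym rFC) (fsubsetIl _ _) QrF cardF.
have rFD : rho F <> D.
  move=> E; apply: nsub; rewrite E in QrF.
  suff <- : (C `&` F)%fset = (C `&` D)%fset by apply: fsubsetIr.
  exact: panel_cap (fsubsetIl _ _) QrF CneD cardF (card_chamber cD hC hD).
have adjD : adjacent Delta D (rho F).
  have := rho_adj _ _ DF; rewrite (rho_id _ SD) => -[E|//].
  by case: rFD.
have := apt_parity cD tA AS SC SD SrF adjD.
by rewrite (adjacent_dist cD adjC) (adjacent_dist cD CD) => -[].
Qed.

(** Passes between a vertex of C missing from D and its opposite panel, which C and D then share. *)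
Lemma adjacent_notin (V : choiceType) (Delta : set {fset V}) C D x :
    chamber_complex Delta -> adjacent Delta C D -> x \in C ->
  x \notin D <-> (C `\ x `<=` D)%fset.
Proof.
move=> cD CD xC; have [hC hD CneD _] := CD.
have cardI := adjacent_cap cD CD; have cardx := card_fsetD1 xC.
split=> [xD|sub].
  suff <- : (C `&` D)%fset = (C `\ x)%fset by apply: fsubsetIr.
  apply: fsub_card_eq; last by rewrite -ltnS -cardx cardI.
  by rewrite fsubsetD1 fsubsetIl inE (negbTE xD) andbF.
apply/negP => xD; apply: CneD; apply: fsub_card_eq; last by rewrite (card_chamber cD hC hD).
by rewrite -(fsetD1K xC) fsubUset fsub1set xD.
Qed.

Lemma adjacent_fsetD1 (V : choiceType) (Delta : set {fset V}) C D :
    chamber_complex Delta -> adjacent Delta C D -> exists2 x, x \in C & x \notin D.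
Proof.
move=> cD CD; have [x [xC xI EI]] := panel_fsetD1 (fsubsetIl C D) (adjacent_cap cD CD).
by exists x => //; move: xI; rewrite inE xC.
Qed.

Lemma adjacent_notin_unique (V : choiceType) (Delta : set {fset V}) C D x y :
    chamber_complex Delta -> adjacent Delta C D ->
  x \in C -> x \notin D -> y \in C -> y \notin D -> x = y.
Proof.
move=> cD CD xC /(adjacent_notin cD CD xC)/fsubsetP sub yC yD.
apply/esym/eqP; apply: contraNT yD => yx; apply: sub.
by rewrite !inE yx.
Qed.

(** * Stars of vertices and the induced vertex map *)

Section ChartStar.
Variables (V : choiceType) (Sigma : set {fset V}) (W : groupType) (S : set W).
Variable d : {fset V} -> W.
Hypothesis ch : chart Sigma S d.

(** Moves the base point of [chart_face] to any chamber containing a. *)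
Lemma chart_star a : Sigma a -> exists J, J `<=` S /\
  forall C D, chamber Sigma C -> chamber Sigma D -> (a `<=` C)%fset ->
    (a `<=` D)%fset <-> generated J ((d C)^-1 * d D)%g.
Proof.
move=> Sa; have [J [w [JS hJ]]] := chart_face ch Sa.
exists J; split=> // C D SC SD /(hJ _ SC) JC; split=> [/(hJ _ SD) JD|JD].
  have -> : ((d C)^-1 * d D = (w^-1 * d C)^-1 * (w^-1 * d D))%g.
    by rewrite invgM invgK -mulgA mulVKg.
  by apply: generatedM => //; apply: generatedV.
apply/(hJ _ SD); have -> : (w^-1 * d D = (w^-1 * d C) * ((d C)^-1 * d D))%g.
  by rewrite -mulgA mulVKg.
exact: generatedM.
Qed.

(** Both C to E and D to G are multiplication by t. If G contained x, then t would lie in the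
    parabolic subgroup attached to x, and E would contain x. *)
Lemma chart_residue C D E G s t x :
    chamber Sigma C -> chamber Sigma D -> chamber Sigma E -> chamber Sigma G ->
    d D = (d C * s)%g -> d E = (d C * t)%g -> d G = (d C * (s * t))%g ->
    Sigma [fset x]%fset -> x \in C -> x \in D -> x \notin E -> x \notin G.
Proof.
move=> SC SD SE SG dD dE dG Sx xC xD; apply: contra => xG.
have [J [JS hJ]] := chart_star Sx.
have xC' : ([fset x] `<=` C)%fset by rewrite fsub1set.
have xD' : ([fset x] `<=` D)%fset by rewrite fsub1set.
rewrite -fsub1set; apply/(hJ _ _ SC SE xC'); rewrite dE mulKg.
have -> : t = ((d D)^-1 * d G)%g by rewrite dG (mulgA (d C)) -dD mulKg.
by apply/(hJ _ _ SD SG xD'); rewrite fsub1set.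
Qed.

End ChartStar.

Section VertexMap.
Variables (V V' : choiceType) (Delta : set {fset V}) (Delta' : set {fset V'}).
Variables (A : set (set {fset V})) (A' : set (set {fset V'})).
Hypotheses (cD : chamber_complex Delta) (tA : tits_axioms Delta A).
Hypotheses (cD' : chamber_complex Delta') (tA' : tits_axioms Delta' A').
Hypothesis thickD : thick Delta.
Variable phi : {fset V} -> {fset V'}.
Hypothesis phi_ch : forall C, chamber Delta C -> chamber Delta' (phi C).
Hypothesis phi_apt : forall Sigma, A Sigma -> exists2 Sigma', A' Sigma' &
  set_bij (chamber Sigma) (chamber Sigma') phi.
Hypothesis spherical : forall Sigma, A Sigma ->
  exists (W : groupType) (S : set W) delta, chart Sigma S delta /\
    forall s t, S s -> S t -> finite_order (s * t)%g.

Let phi_adj := phi_adjacent cD tA cD' tA' thickD phi_ch phi_apt.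
Let phi_iso := phi_dist cD tA cD' tA' thickD phi_ch phi_apt.
Let phiI := phi_inj tA phi_apt.

(* The vertex z of phi C is opposite to the image of the panel of C opposite
   to x.  This is a relation because V' may be empty while V is not. *)
Definition vertex_match C x z := [/\ chamber Delta C, x \in C, z \in phi C &
  forall D, adjacent Delta C D -> x \notin D -> z \notin phi D].

Lemma opposite_chamber C x : chamber Delta C -> x \in C ->
  forall Sigma, A Sigma -> chamber Sigma C ->
  exists D, [/\ chamber Sigma D, adjacent Delta C D & x \notin D].
Proof.
move=> hC xC Sigma AS SC.
have [D [SD PD DC]] := apt_other tA AS SC (fsubD1set C x) (card_fsetD1 xC).
have hD := apt_chamber cD tA AS SD.
have adj := panel_adjacent cD hC hD (nesym DC) (fsubD1set C x) PD (card_fsetD1 xC).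
by exists D; split=> //; apply/(adjacent_notin cD adj xC).
Qed.

(** One chamber D opposite to x suffices: another one, E, shares the same panel with C and D, so the
    three images are pairwise adjacent and share a panel by [adjacent_triple]. *)
Lemma vertex_match_of C D x z : adjacent Delta C D -> x \in C -> x \notin D ->
  z \in phi C -> z \notin phi D -> vertex_match C x z.
Proof.
move=> CD xC xD zC zD; have [hC hD _ _] := CD; split=> // E CE xE.
have [<-//|DneE] := lem (D = E).
have hE : chamber Delta E by case: CE.
have DE : adjacent Delta D E.
  have PD := (adjacent_notin cD CD xC).1 xD; have PE := (adjacent_notin cD CE xC).1 xE.
  by apply: panel_adjacent PD PE _ => //; rewrite (card_chamber cD hD hC) (card_fsetD1 xC).
have sub := adjacent_triple cD' tA' (phi_adj CD) (phi_adj CE) (phi_adj DE).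
apply/(adjacent_notin cD' (phi_adj CE) zC); apply: fsubset_trans sub.
by rewrite fsubsetI fsubD1set; apply/(adjacent_notin cD' (phi_adj CD) zC).
Qed.

Lemma vertex_match_exists C x : chamber Delta C -> x \in C -> exists z, vertex_match C x z.
Proof.
move=> hC xC; have [Sigma [AS SC _]] := apt_through_chambers tA hC hC.
have [D [SD CD xD]] := opposite_chamber hC xC AS SC.
have [z zC zD] := adjacent_fsetD1 cD' (phi_adj CD).
by exists z; apply: vertex_match_of CD xC xD zC zD.
Qed.

Lemma vertex_match_fun C x z z' : vertex_match C x z -> vertex_match C x z' -> z = z'.
Proof.
move=> [hC xC zC mz] [_ _ zC' mz'].
have [Sigma [AS SC _]] := apt_through_chambers tA hC hC.
have [D [SD CD xD]] := opposite_chamber hC xC AS SC.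
exact: (adjacent_notin_unique cD' (phi_adj CD) zC (mz _ CD xD) zC' (mz' _ CD xD)).
Qed.

Lemma vertex_match_inj C x y z : vertex_match C x z -> vertex_match C y z -> x = y.
Proof.
move=> [hC xC zC mx] [_ yC _ my].
have [Sigma [AS SC _]] := apt_through_chambers tA hC hC.
have [D [SD CD xD]] := opposite_chamber hC xC AS SC.
have [E [SE CE yE]] := opposite_chamber hC yC AS SC.
have [Sigma' AS' [fn inj _]] := phi_apt AS.
have zD := mx _ CD xD; have zE := my _ CE yE.
have DE : D = E.
  apply: inj; rewrite ?inE //.
  have PD := (adjacent_notin cD' (phi_adj CD) zC).1 zD.
  have PE := (adjacent_notin cD' (phi_adj CE) zC).1 zE.
  apply: (apt_thin tA' AS' (fn _ SC) (fn _ SD) (fn _ SE) _ PD PE (card_fsetD1 zC)).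
  - exact: fsubD1set.
  - by case: (phi_adj CD) => _ _ /nesym.
  - by case: (phi_adj CE) => _ _ /nesym.
rewrite -DE in yE; exact: (adjacent_notin_unique cD CD xC xD yC yE).
Qed.

Lemma vertex_match_surj C z : chamber Delta C -> z \in phi C -> exists x, vertex_match C x z.
Proof.
move=> hC zC; have [Sigma [AS SC _]] := apt_through_chambers tA hC hC.
have [Sigma' AS' [fn inj surj]] := phi_apt AS.
have [D' [SD' PD' DC']] := apt_other tA' AS' (fn _ SC) (fsubD1set _ z) (card_fsetD1 zC).
have [D SD ED] := surj _ SD'; subst D'.
have hD := apt_chamber cD tA AS SD.
have adj' := panel_adjacent cD' (phi_ch hC) (phi_ch hD) (nesym DC') (fsubD1set _ z) PD' (card_fsetD1 zC).
(* Preservation of distance makes [phi] reflect adjacency. *)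
have CD : adjacent Delta C D.
  by apply: (dist_adjacent cD hC hD); rewrite -phi_iso // adjacent_dist.
have [x xC xD] := adjacent_fsetD1 cD CD.
exists x; apply: (vertex_match_of CD xC xD zC).
exact/(adjacent_notin cD' adj' zC).
Qed.

(** With E opposite to x at C, the chamber G at position s t from C is opposite to x at D. By
    [isometry_residue] its image is at position s' t' from [phi C], hence opposite to z at
    [phi D]. *)
Lemma vertex_match_adjacent C D x z : adjacent Delta C D -> x \in D ->
  vertex_match C x z -> vertex_match D x z.
Proof.
move=> CD xD [hC xC zC mz]; have [_ hD CneD _] := CD.
have [Sigma [AS SC SD]] := apt_through_chambers tA hC hD.
have [Sigma' AS' [fn inj surj]] := phi_apt AS.
have [W [S [d [ch sph]]]] := spherical AS.
have [W' [S' [d' ch']]] := apt_chart tA' AS'.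
have [HS HS'] := (chart_coxeter ch, chart_coxeter ch').
have [E [SE CE xE]] := opposite_chamber hC xC AS SC.
have hE := apt_chamber cD tA AS SE; have CneE : C <> E by case: CE.
pose s := ((d C)^-1 * d D)%g; pose t := ((d C)^-1 * d E)%g.
have dD : d D = (d C * s)%g by rewrite mulVKg.
have dE : d E = (d C * t)%g by rewrite mulVKg.
have Ss : S s by apply/(chart_adjacent cD tA AS ch SC SD).
have St : S t by apply/(chart_adjacent cD tA AS ch SC SE).
have st : s <> t.
  move=> st; have DE : D = E by apply: (chart_inj ch SD SE); rewrite dD st -dE.
  by move: xE; rewrite -DE xD.
have [G SG dG] := chart_surj ch (d C * (s * t))%g.
have hG := apt_chamber cD tA AS SG.
have DG : adjacent Delta D G.
  by apply/(chart_adjacent cD tA AS ch SD SG); rewrite dG (mulgA (d C)) -dD mulKg.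
have /choice[inv invP] w : exists X, chamber Sigma X /\ d X = w.
  by have [X] := chart_surj ch w; exists X.
(* F is [phi] read in coordinates, an isometry of Cayley graphs. *)
pose F w := d' (phi (inv w)).
have invK X : chamber Sigma X -> inv (d X) = X.
  by move=> SX; apply: (chart_inj ch) => //; case: (invP (d X)).
have Fd X : chamber Sigma X -> F (d X) = d' (phi X) by move=> /invK; rewrite /F => ->.
have Fsurj w' : exists w, F w = w'.
  have [X' SX' <-] := chart_surj ch' w'; have [X SX <-] := surj _ SX'.
  by exists (d X); apply: Fd.
have Fiso u v : cdist S' (F u) (F v) = cdist S u v.
  have [[Su du] [Sv dv]] := (invP u, invP v).
  rewrite /F -(chart_dist cD' tA' AS' ch' (fn _ Su) (fn _ Sv)).
  rewrite phi_iso; try exact: (apt_chamber cD tA AS).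
  by rewrite (chart_dist cD tA AS ch Su Sv) du dv.
pose s' := ((d' (phi C))^-1 * d' (phi D))%g.
pose t' := ((d' (phi C))^-1 * d' (phi E))%g.
have Ss' : S' s' by apply/(chart_adjacent cD' tA' AS' ch' (fn _ SC) (fn _ SD)); apply: phi_adj.
have St' : S' t' by apply/(chart_adjacent cD' tA' AS' ch' (fn _ SC) (fn _ SE)); apply: phi_adj.
have dD' : d' (phi D) = (d' (phi C) * s')%g by rewrite mulVKg.
have dE' : d' (phi E) = (d' (phi C) * t')%g by rewrite mulVKg.
have [n n0 stn] := sph _ _ Ss St.
have := isometry_residue HS HS' Fsurj Fiso Ss St st Ss' St' n0 stn (w := d C).
rewrite -dD -dE -dG !Fd // => /(_ dD' dE') dG'.
have xG : x \notin G.
  have := chart_residue ch SC SD SE SG dD dE dG _ xC xD xE.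
  by apply; apply: face (apt_complex tA AS) (chamber_simplex SC) _; rewrite fsub1set.
have zE := mz _ CE xE.
(* Otherwise [phi D] and [phi E] share with [phi C] the panel opposite to z, so D = E by thinness,
   although only D contains x. *)
have zD : z \in phi D.
  apply: contraT => zD.
  have DE : phi D = phi E.
    have PD := (adjacent_notin cD' (phi_adj CD) zC).1 zD.
    have PE := (adjacent_notin cD' (phi_adj CE) zC).1 zE.
    apply: (apt_thin tA' AS' (fn _ SC) (fn _ SD) (fn _ SE) _ PD PE (card_fsetD1 zC)).
    - exact: fsubD1set.
    - by move/(phiI hD hC)/esym.
    - by move/(phiI hE hC)/esym.
  by move: xE; rewrite -(phiI hD hE DE) xD.
apply: (vertex_match_of DG xD xG zD).
have := chart_residue ch' (fn _ SC) (fn _ SD) (fn _ SE) (fn _ SG) dD' dE' dG' _ zC zD zE.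
by apply; apply: face (apt_complex tA' AS') (chamber_simplex (fn _ SC)) _; rewrite fsub1set.
Qed.

(** Within an apartment through C and D, the chambers containing x form a coset of a parabolic
    subgroup. A word in its generators gives a gallery from C to D inside the star, along which the
    match is carried. *)
Lemma vertex_match_star C D x z : chamber Delta D -> x \in D ->
  vertex_match C x z -> vertex_match D x z.
Proof.
move=> hD xD mC; have [hC xC _ _] := mC.
have [Sigma [AS SC SD]] := apt_through_chambers tA hC hD.
have [W [S [d ch]]] := apt_chart tA AS.
have Sx : Sigma [fset x]%fset.
  by apply: face (apt_complex tA AS) (chamber_simplex SC) _; rewrite fsub1set.
have [J [JS hJ]] := chart_star ch Sx; have HS := chart_coxeter ch.
have iJ : involutions J by move=> s /JS; apply: (coxeter_involutions HS).
have /(generatedP _ iJ)[ws hws Ews] : generated J ((d C)^-1 * d D)%g.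
  by apply/hJ; rewrite // fsub1set.
have {Ews} : d D = (d C * wprod ws)%g by rewrite Ews mulVKg.
elim: ws C SC mC hws {hC xC} => [|s ws IH] C SC mC hws /=.
  by rewrite mulg1 => /(chart_inj ch SD SC) ->.
have [Js hws'] := (word_cons _ _ _).1 hws; have [hC xC _ _] := mC.
have [E SE dE] := chart_surj ch (d C * s)%g.
rewrite mulgA -dE => /(IH E SE _ hws'); apply.
apply: vertex_match_adjacent mC.
  by apply/(chart_adjacent cD tA AS ch SC SE); rewrite dE mulKg; apply: JS.
rewrite -fsub1set; apply/(hJ C E) => //; first by rewrite fsub1set.
by rewrite dE mulKg; apply: sub_generated.
Qed.

(** The same argument in the star of z: a gallery in the image apartment lifts through [phi], and
    each lifted chamber still contains x, for otherwise z would be missing from its image. At D the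
    match is injective. *)
Lemma vertex_match_global C D x y z : vertex_match C x z -> vertex_match D y z -> x = y.
Proof.
move=> mC mD; have [[hC _ zC _] [hD _ zD _]] := (mC, mD).
have [Sigma [AS SC SD]] := apt_through_chambers tA hC hD.
have [Sigma' AS' [fn inj surj]] := phi_apt AS.
have [W' [S' [d' ch']]] := apt_chart tA' AS'; have HS' := chart_coxeter ch'.
have Sz : Sigma' [fset z]%fset.
  by apply: face (apt_complex tA' AS') (chamber_simplex (fn _ SC)) _; rewrite fsub1set.
have [J [JS hJ]] := chart_star ch' Sz.
have iJ : involutions J by move=> s /JS; apply: (coxeter_involutions HS').
have /(generatedP _ iJ)[ws hws Ews] : generated J ((d' (phi C))^-1 * d' (phi D))%g.
  by apply/hJ; rewrite ?fsub1set //; apply: fn.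
have {Ews} : d' (phi D) = (d' (phi C) * wprod ws)%g by rewrite Ews mulVKg.
elim: ws C SC mC hws {hC zC} => [|s ws IH] C SC mC hws /=.
  rewrite mulg1 => /(chart_inj ch' (fn _ SD) (fn _ SC)) /phiI E.
  have [hC _ _ _] := mC; rewrite (E hD hC) in mD; exact: vertex_match_inj mC mD.
have [Js hws'] := (word_cons _ _ _).1 hws; have [hC xC zC _] := mC.
have [E' SE' dE] := chart_surj ch' (d' (phi C) * s)%g.
have [E SE EE] := surj _ SE'; subst E'.
have hE := apt_chamber cD tA AS SE.
rewrite mulgA -dE => /(IH E SE _ hws'); apply.
have adj' : adjacent Delta' (phi C) (phi E).
  by apply/(chart_adjacent cD' tA' AS' ch' (fn _ SC) SE'); rewrite dE mulKg; apply: JS.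
have zE : z \in phi E.
  rewrite -fsub1set; apply/(hJ (phi C)) => //; rewrite ?fsub1set //; first exact: fn.
  by rewrite dE mulKg; apply: sub_generated.
have CE : adjacent Delta C E.
  by apply: (dist_adjacent cD hC hE); rewrite -phi_iso // adjacent_dist.
apply: (vertex_match_adjacent CE _ mC).
apply: contraLR zE => xE; by case: mC => _ _ _; apply.
Qed.

Lemma induced_map : exists f,
  simplicial_iso Delta (generated_subcomplex [set phi C | C in chamber Delta]) f /\
  forall C, chamber Delta C -> f C = phi C.
Proof.
pose vm x z := exists C, vertex_match C x z.
have vm_in C x z : chamber Delta C -> x \in C -> vm x z -> vertex_match C x z.
  by move=> hC xC [D /vertex_match_star]; apply.
pose ch a := xget fset0 [set C | chamber Delta C /\ (a `<=` C)%fset].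
have chP a : Delta a -> chamber Delta (ch a) /\ (a `<=` ch a)%fset.
  move=> /(in_chamber cD)[C hC aC].
  by apply: (@xgetI _ _ [set C | chamber Delta C /\ (a `<=` C)%fset] C).
(* The chosen chamber provides a finite set to select from; by [f_mem] the result does not depend on
   it. *)
pose f a := [fset z in phi (ch a) | `[<exists2 x, x \in a & vm x z>]]%fset.
have f_mem a z : Delta a -> z \in f a <-> exists2 x, x \in a & vm x z.
  move=> Da; have [hC aC] := chP _ Da; rewrite !inE; split=> [/andP[_ /asboolP]//|ex].
  apply/andP; split; last exact/asboolP.
  case: ex => x xa /(vm_in _ _ _ hC (fsubsetP aC _ xa)) m; by case: m.
have fE C : chamber Delta C -> f C = phi C.
  move=> hC; apply/fsetP => z; apply/idP/idP.
    move=> /(f_mem _ _ (chamber_simplex hC))[x xC /(vm_in _ _ _ hC xC) m]; by case: m.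
  move=> zC; apply/f_mem; first exact: chamber_simplex.
  have [x m] := vertex_match_surj hC zC; exists x; first by case: m.
  by exists C.
have f_sub a b : Delta a -> Delta b -> (a `<=` b)%fset <-> (f a `<=` f b)%fset.
  move=> Da Db; split=> /fsubsetP ab; apply/fsubsetP.
    by move=> z /(f_mem _ _ Da)[x xa m]; apply/f_mem => //; exists x => //; apply: ab.
  move=> x xa; have [hC aC] := chP _ Da.
  have [z m] := vertex_match_exists hC (fsubsetP aC _ xa).
  have /ab/(f_mem _ _ Db)[y yb [D mD]] : z \in f a by apply/f_mem => //; exists x => //; exists (ch a).
  by rewrite (vertex_match_global m mD).
exists f; split=> //; split=> //; split.
- move=> a Da; have [hC aC] := chP _ Da; exists (phi (ch a)); first by exists (ch a).
  by rewrite -fE //; apply/f_sub => //; apply: chamber_simplex.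
- move=> a b; rewrite !inE => Da Db E.
  by apply/eqP; rewrite eqEfsubset; apply/andP; split; apply/f_sub; rewrite ?E.
- move=> B [_ [C hC <-] BC].
  (* The preimage of a face B of [phi C] consists of the vertices of C matched with those of B. *)
  pose a := [fset x in C | `[<exists2 z, z \in B & vm x z>]]%fset.
  have aC : (a `<=` C)%fset by apply/fsubsetP => x; rewrite !inE => /andP[].
  have Da : Delta a by case: cD => sD _ _ _; apply: face sD (chamber_simplex hC) aC.
  exists a => //; apply/fsetP => z; apply/idP/idP.
    move=> /(f_mem _ _ Da)[x xa m]; have xC := fsubsetP aC _ xa.
    move: xa; rewrite !inE => /andP[_ /asboolP[z' z'B m']].
    by rewrite (vertex_match_fun (vm_in _ _ _ hC xC m) (vm_in _ _ _ hC xC m')).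
  move=> zB; have [x m] := vertex_match_surj hC (fsubsetP BC _ zB).
  apply/f_mem => //; exists x; last by exists C.
  rewrite !inE; apply/andP; split; first by case: m.
  by apply/asboolP; exists z => //; exists C.
Qed.

End VertexMap.

(** * Transport along isomorphisms *)

Section Transport.
Variables (V V' : choiceType) (K : set {fset V}) (L : set {fset V'}).
Variable f : {fset V} -> {fset V'}.
Hypotheses (cK : simplicial_complex K) (cL : simplicial_complex L).
Hypothesis isof : simplicial_iso K L f.

Lemma iso_restrict Sigma : Sigma `<=` K -> simplicial_iso Sigma (f @` Sigma) f.
Proof.
move=> SK; split; first split.
- by move=> a Sa; exists a.
- by move=> a b; rewrite !inE => /SK Ka /SK Kb; apply: (iso_inj isof).
- by [].
- by move=> a b /SK Ka /SK Kb; rewrite (iso_sub isof).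
Qed.

Lemma iso_image_complex Sigma : Sigma `<=` K -> simplicial_complex Sigma ->
  simplicial_complex (f @` Sigma).
Proof.
move=> SK [S0 Sd]; split; first by exists fset0 => //; apply: iso0 cK cL isof.
move=> B _ [a Sa <-] Bfa; have Ka := SK _ Sa.
have [b Kb Eb] := iso_surj isof (face cL (iso_fun isof Ka) Bfa).
by exists b => //; apply: Sd Sa _; rewrite -(iso_sub isof Kb Ka) Eb.
Qed.

Lemma iso_chamber_complex : chamber_complex K -> chamber_complex L.
Proof.
move=> [_ [n hn] eqc conn].
have lift C : chamber L C -> exists2 D, chamber K D & f D = C.
  move=> hC; have [D KD ED] := iso_surj isof (chamber_simplex hC).
  by exists D => //; apply/(iso_chamber isof KD); rewrite ED.
split=> //.
- by exists n => B /(iso_surj isof)[a Ka <-]; rewrite (iso_card cK cL isof Ka); apply: hn.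
- move=> _ _ /lift[C hC <-] /lift[D hD <-].
  by rewrite !(iso_card cK cL isof) ?(eqc _ _ hC hD) //; apply: chamber_simplex.
- move=> _ _ /lift[C hC <-] /lift[D hD <-].
  elim: (conn C D hC hD) => [x y xy|x|x y z _ h1 _ h2].
  + apply: rt_step; have [/chamber_simplex Kx /chamber_simplex Ky _ _] := xy.
    exact/(iso_adjacent cK cL isof).
  + exact: rt_refl.
  + exact: rt_trans h1 h2.
Qed.

Lemma iso_thick : thick K -> thick L.
Proof.
move=> thK P' pP'; have [C' hC' [PC' _]] := pP'.
have [P KP EP] := iso_surj isof (face cL (chamber_simplex hC') PC').
have /thK : panel K P by apply/(iso_panel cK cL isof KP); rewrite EP.
move=> [C1 [C2 [C3 [[h1 h2 h3] [[n12 n13 n23] [P1 P2 P3]]]]]].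
have [k1 k2 k3] := And3 (chamber_simplex h1) (chamber_simplex h2) (chamber_simplex h3).
exists (f C1), (f C2), (f C3); rewrite -EP !(iso_sub isof) //.
split; first by split; apply/(iso_chamber isof).
by do 2?split=> //; move/(iso_inj isof); auto.
Qed.

Lemma iso_coxeter (W : groupType) (S : set W) :
  iso_coxeter_complex S K -> iso_coxeter_complex S L.
Proof.
move=> [g [gfun ginj gsurj] gsub].
have [h [isoh hf fh]] := iso_inverse isof.
exists (g \o h); first split.
- by move=> B /(iso_fun isoh) /gfun.
- move=> a b; rewrite !inE => La Lb E; apply: (iso_inj isoh La Lb).
  by apply: ginj; rewrite ?inE //; apply: (iso_fun isoh).
- move=> X /gsurj[a Ka <-]; exists (f a); first exact: (iso_fun isof).
  by rewrite /= hf.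
- move=> a b La Lb; rewrite -gsub; try exact: (iso_fun isoh).
  by rewrite (iso_sub isoh).
Qed.

End Transport.

Section TransportBuilding.
Variables (V V' : choiceType) (K : set {fset V}) (L : set {fset V'}).
Variable f : {fset V} -> {fset V'}.
Hypotheses (cK : simplicial_complex K) (cL : simplicial_complex L).
Hypothesis isof : simplicial_iso K L f.

Lemma iso_tits A : tits_axioms K A -> tits_axioms L [set f @` Sigma | Sigma in A].
Proof.
move=> [t1 t2 t3 t4].
have sub Sigma : A Sigma -> Sigma `<=` K by move=> /t1[].
have cpl Sigma : A Sigma -> simplicial_complex (f @` Sigma).
  by move=> AS; apply: (iso_image_complex cK cL isof (sub _ AS)); case: (t1 _ AS).
split.
- move=> _ [Sigma AS <-]; split; last exact: cpl.
  by move=> _ [a /(sub _ AS) Ka <-]; apply: (iso_fun isof).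
- move=> _ [Sigma AS <-]; have [W [S [HS fS iS]]] := t2 _ AS.
  exists W, S; split=> //; have [SK cS] := t1 _ AS.
  exact: (iso_coxeter (iso_restrict isof SK)).
- move=> _ _ /(iso_surj isof)[a Ka <-] /(iso_surj isof)[b Kb <-].
  have [Sigma [AS Sa Sb]] := t3 _ _ Ka Kb.
  by exists (f @` Sigma); split; [exists Sigma|exists a|exists b].
move=> _ _ a' b' [Sigma AS <-] [Sigma' AS' <-].
have [[SK cS] [SK' cS']] := (t1 _ AS, t1 _ AS').
move=> [a Sa Ea] [b Sb Eb] [a1 Sa1 Ea1] [b1 Sb1 Eb1].
have Ea' : a1 = a by apply: (iso_inj isof); [exact: SK'|exact: SK|rewrite Ea1 Ea].
have Eb' : b1 = b by apply: (iso_inj isof); [exact: SK'|exact: SK|rewrite Eb1 Eb].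
subst a' b' a1 b1.
have [h isoh hid] := t4 _ _ _ _ AS AS' Sa Sb Sa1 Sb1.
have isoS := iso_restrict isof SK; have isoS' := iso_restrict isof SK'.
have [g [isog gf fg]] := iso_inverse isoS.
(* The isomorphism h between the original apartments is conjugated by f. *)
exists (f \o (h \o g)); first exact: iso_comp (iso_comp isog isoh) isoS'.
move=> c hc; have Sc : (f @` Sigma) c.
  have [Ka Kb] := (SK _ Sa, SK _ Sb).
  by case: hc => sc; apply: face (cpl _ AS) _ sc; [exists a|exists b].
have [c0 Sc0 Ec] := Sc; subst c.
have [Ka Kb Kc0] := And3 (SK _ Sa) (SK _ Sb) (SK _ Sc0).
by rewrite !(iso_sub isof) // in hc; rewrite /= gf // hid.
Qed.

End TransportBuilding.

Lemma iso_complete (V V' : choiceType) (K : set {fset V}) (L : set {fset V'}) f A :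
    simplicial_complex K -> simplicial_complex L -> simplicial_iso K L f ->
  complete_apartment_system K A -> complete_apartment_system L [set f @` Sigma | Sigma in A].
Proof.
move=> cK cL isof [tA maxA]; split; first exact: (iso_tits cK cL isof).
move=> B tB Sigma BS; have [g [isog gf fg]] := iso_inverse isof.
(* The system B pulls back along g to a system of K, which maximality places inside A. *)
exists (g @` Sigma); first by apply: (maxA _ (iso_tits cL cK isog tB)); exists Sigma.
have SL : Sigma `<=` L by case: tB => h _ _ _; case: (h _ BS).
apply/seteqP; split=> [_ [_ [b Sb <-] <-]|b Sb]; first by rewrite fg //; apply: SL.
by exists (g b); [exists b|rewrite fg //; apply: SL].
Qed.

(** The type may be given with another complete system than the one containing A; by maximality the
    former contains the latter. *)
Lemma two_spherical_charts (V : choiceType) (Delta : set {fset V}) A :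
    apartment_system Delta A -> two_spherical Delta ->
  forall Sigma, A Sigma -> exists (W : groupType) (S : set W) delta,
    chart Sigma S delta /\ forall s t, S s -> S t -> finite_order (s * t)%g.
Proof.
move=> [Ac [tAc _] [AAc _]] [W [S [[HS [Ac' [_ maxAc'] isoAc']] sph]]] Sigma AS.
have cS : simplicial_complex Sigma by case: tAc => h _ _ _; case: (h _ (AAc _ AS)).
have [delta ch] := chart_exists cS HS (isoAc' _ (maxAc' _ tAc _ (AAc _ AS))).
by exists W, S, delta.
Qed.

Theorem proposition2p6 (V V' : choiceType)
    (Delta : set {fset V}) (Delta' : set {fset V'})
    (A : set (set {fset V})) (A' : set (set {fset V'}))
    (hDelta : building Delta) (hthick : thick Delta)
    (hDelta' : building Delta')
    (hA : apartment_system Delta A) (hA' : apartment_system Delta' A')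
    (phi : {fset V} -> {fset V'})
    (hphi : set_fun (chamber Delta) (chamber Delta') phi)
    (hap : forall Sigma, A Sigma -> exists2 Sigma', A' Sigma' &
             set_bij (chamber Sigma) (chamber Sigma') phi) :
  set_inj (chamber Delta) phi /\
  (forall C D, adjacent Delta C D -> adjacent Delta' (phi C) (phi D)) /\
  (two_spherical Delta ->
     exists (Gamma : set {fset V'}) (f : {fset V} -> {fset V'}),
       subbuilding Delta' A' Gamma /\ thick Gamma /\
       simplicial_iso Delta Gamma f /\
       (forall C, chamber Delta C -> f C = phi C)).
Proof.
have [cD _] := hDelta; have [cD' _] := hDelta'.
have tA := apartment_system_tits cD hA; have tA' := apartment_system_tits cD' hA'.
split; first by move=> C D; rewrite !inE; apply: (phi_inj tA hap).
split; first exact: (phi_adjacent cD tA cD' tA' hthick hphi hap).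
move=> sph; have charts := two_spherical_charts hA sph.
have [f [isof fE]] := induced_map cD tA cD' tA' hthick hphi hap charts.
set Gamma := generated_subcomplex _ in isof; exists Gamma, f.
have sD : simplicial_complex Delta by case: cD.
have cG : simplicial_complex Gamma.
  split=> [|a b [C hC bC] ab]; last by exists C => //; apply: fsubset_trans ab bC.
  have [D0 _] := sD; have [C hC _] := in_chamber cD D0.
  by exists (phi C) => //; exists C.
have [Ac complA [AAc cov]] := hA; have [tAc _] := complA.
split; last by split=> //; apply: (iso_thick sD cG isof hthick).
split.
- exists [set phi C | C in chamber Delta] => //.
  by move=> _ [C hC <-]; apply: hphi.
- split; first exact: (iso_chamber_complex sD cG isof cD).
  by exists [set f @` Sigma | Sigma in A]; apply: (iso_tits sD cG isof).
exists [set f @` Sigma | Sigma in A].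
  move=> _ [Sigma AS <-]; have [Sigma' AS' [fn _ surj]] := hap _ AS.
  (* Each simplex of an apartment is a face of one of its chambers, and f extends [phi], so f
     carries Sigma onto the apartment spanned by the images of its chambers. *)
  suff -> : f @` Sigma = Sigma' by [].
  have cS' := apt_complex tA' AS'; apply/seteqP; split=> [_ [a Sa <-]|b Sb].
    have [C SC aC] := in_apt_chamber cD tA AS Sa.
    have hC := apt_chamber cD tA AS SC.
    have [Da DC] := (apt_sub tA AS Sa, chamber_simplex hC).
    apply: face cS' (chamber_simplex (fn _ SC)) _.
    by rewrite -fE // (iso_sub isof).
  have [D' SD' bD] := in_apt_chamber cD' tA' AS' Sb.
  have [D SD ED] := surj _ SD'; subst D'.
  have hD := apt_chamber cD tA AS SD.
  have Gb : Gamma b by exists (phi D) => //; exists D.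
  have [a Da Ea] := iso_surj isof Gb; exists a => //.
  apply: face (apt_complex tA AS) (chamber_simplex SD) _.
  by rewrite -(iso_sub isof Da (chamber_simplex hD)) Ea fE.
(* The complete system of [Gamma] is the image under f of that of [Delta]. *)
exists [set f @` Sigma | Sigma in Ac]; first exact: (iso_complete sD cG isof).
split=> [_ [Sigma AS <-]|C' D' hC' hD']; first by exists Sigma => //; apply: AAc.
have [C DC EC] := iso_surj isof (chamber_simplex hC').
have [D DD ED] := iso_surj isof (chamber_simplex hD').
have hC : chamber Delta C by apply/(iso_chamber isof DC); rewrite EC.
have hD : chamber Delta D by apply/(iso_chamber isof DD); rewrite ED.
have [Sigma [AS SC SD]] := cov _ _ hC hD.
by exists (f @` Sigma); split; [exists Sigma|exists C|exists D].
Qed.
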